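(* For every $\mathbf Q$-module $M\in\widehat{\mathbf Q}$, the $\Sigma$-monoid $\widehat{\mathbf Q}(M,I)$ is cancellable and $\omega$-complete. The poset $(\widehat{\mathbf Q}(M,I),\le)$, with $\le$ the canonical order, is an $\omega$CPO (every increasing $\omega$-chain has a least upper bound), and every countable sum is the least upper bound of its finite partial sums: $$\sum_{i\in J}f_i\;\simeq\;\text{least upper bound of }\Big\{\sum_{i\in J'}f_i\;\Big|\;J'\subseteq J\text{ finite}\Big\}$$ (one side is defined iff the other is, and then they are equal; the right-hand side is regarded as undefined if some finite partial sum is undefined). In particular, $\overline{\mathbf Q}(M,N)$ has all of these properties for all $M,N\in\overline{\mathbf Q}$.
   Context: **Superoperators.** For $n,m\in\mathbb N$, $\mathbf{CPM}(n,m)$ is the set of completely positive $\mathbb C$-linear maps $\mathrm{Mat}_n(\mathbb C)\to\mathrm{Mat}_m(\mathbb C)$, and $\mathbf Q(n,m)\subseteq\mathbf{CPM}(n,m)$ is the subset of superoperators, i.e. those $\varphi$ with $\mathrm{tr}\,\varphi(x)\le\mathrm{tr}\,x$ for all positive semidefinite $x$. Both are categories with object set $\mathbb N$ and composition of functions, and are symmetric (strict) monoidal with $n\otimes m=nm$, unit $1$, via $\mathrm{Mat}_n(\mathbb C)\otimes\mathrm{Mat}_m(\mathbb C)\cong\mathrm{Mat}_{nm}(\mathbb C)$. **$\Sigma$-monoids.** For partially defined expressions, $e\sqsubseteq e'$ means: if $e$ is defined then $e'$ is defined with the same value; $e\simeq e'$ means both $e\sqsubseteq e'$ and $e'\sqsubseteq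 e$. A $\Sigma$-monoid is a set $M$ with a partial operation $\sum$ on countable families such that: the empty sum is defined (written $0$); singleton sums satisfy $\sum(x)=x$; omitting zero elements from a family does not change the sum (in the sense of $\simeq$); sums are invariant under reindexing by a bijection (in the sense of $\simeq$); and $\sum_{i}\big(\sum_{j\in J_i}x_{i,j}\big)\simeq\sum_{i\in I,j\in J_i}x_{i,j}$. A homomorphism is a function with $f(\sum_i x_i)\sqsubseteq\sum_i f(x_i)$. A map $f$ of two arguments is bilinear if $f(\sum_i x_i,\sum_j y_j)\sqsubseteq\sum_{i,j}f(x_i,y_j)$. The canonical pre-order is $x\le y:\Leftrightarrow\exists z.\,x+z=y$. A $\Sigma$-monoid is $\omega$-complete if a countable sum is defined whenever all its finite partial sums are, and cancellable if $x+y=x+z$ (both defined) implies $y=z$; the canonical pre-order of a cancellable $\Sigma$-monoid is a partial order. $\mathbf{CPM}(n,m)$ is a $\Sigma$-monoid (finite sums always defined; infinite sums are limits of finite partial sums, when they converge), and $\mathbf Q(n,m)$ is one by restriction: a sum is defined in $\mathbf Q(n,m)$ iff it is defined in $\mathbf{CPM}(n,m)$ with value in $\mathbf Q(n,m)$. **$\mathbf Q$-modules.** A $\mathbf Q$-module $M$ is a family $(M_n)_{n\in\mathbb N}$ of $\Sigma$-monoids with bilinear actions $M_n\times\mathbf Q(m,n)\to M_m$, $(x,\varphi)\mapsto x\cdot\varphi$, such that $x\cdot\mathrm{id}=x$ and $(x\cdot\varphi)\cdot\psi=x\cdot(\varphi\circ\psi)$. A morphism $f:M\to N$ is a family of $\Sigma$-monoid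 homomorphisms $f_n:M_n\to N_n$ with $f_m(x\cdot\varphi)=f_n(x)\cdot\varphi$. The category is $\widehat{\mathbf Q}$. Hom-sets are $\Sigma$-monoids with pointwise sums (a sum of morphisms is defined iff it is defined in each component at each element). $\mathbf y(n)=\mathbf Q(-,n)$ and $I=\mathbf y(1)$. **Linear structure.** A bilinear map from $M,N$ to $L$ is a family of bilinear maps $f_{m,n}:M_m\times N_n\to L_{m\otimes n}$ with $f(x\cdot\varphi,y\cdot\psi)=f(x,y)\cdot(\varphi\otimes\psi)$. $M\hat\otimes N$ is the $\mathbf Q$-module representing bilinear maps; $M\multimap(-)$ is the right adjoint of $(-)\hat\otimes M$; $\neg M:=M\multimap I$. **Classical modules.** A representable basis of $M$ is a countable family $(n_i,e_i,f_i)_i$ with $n_i\in\mathbb N$, $e_i\in M_{n_i}$, $f_i:M\to\mathbf y(n_i)$ such that $x=\sum_i e_i\cdot(f_i)_k(x)$ for all $k$ and $x\in M_k$. $\overline{\mathbf Q}$ is the full subcategory of $\widehat{\mathbf Q}$ of modules $M$ that have a representable basis and for which the canonical morphism $M\to\neg\neg M$ is an isomorphism. *)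

(* Defs.v *)
(* The field of complex numbers is R[i], over an arbitrary R : realType. *)
From HB Require Import structures.
From mathcomp Require Import all_boot all_order all_algebra finmap.
From mathcomp Require Import all_classical all_reals all_analysis.
From mathcomp.real_closed Require Import complex mxtens.
From mathcomp.analysis.showcase Require summability.
From mathcomp Require Import ring lra.
Import numFieldNormedType.Exports.
Set Implicit Arguments.
Unset Strict Implicit.
Unset Printing Implicit Defensive.
Import Order.TTheory GRing.Theory Num.Theory.

(* The partial operation is encoded by its graph: [ssum x s] reads "the sum of
   the family x is defined, with value s".  Countable families are those indexed
   by a countType (finite or infinite).  A Kleene equality e ~ e' of partial
   expressions becomes [forall s, (e has value s) <-> (e' has value s)]; a nested
   sum has a value when all its inner sums do and the outer sum of these does. *)
Record sigmaMonoid := SigmaMonoid {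
  sm_car :> Type;
  ssum : forall J : countType, (J -> sm_car) -> sm_car -> Prop;
  szero : sm_car;
  sum_uniq : forall (J : countType) (x : J -> sm_car) s t,
    ssum x s -> ssum x t -> s = t;
  sum_empty : ssum (of_void sm_car) szero;
  sum_single : forall x, ssum (fun _ : unit => x) x;
  sum_omit : forall (J : countType) (P : pred J) (x : J -> sm_car),
    (forall j, ~~ P j -> x j = szero) ->
    forall s, ssum (fun j : {j | P j} => x (val j)) s <-> ssum x s;
  sum_reindex : forall (J K : countType) (h : K -> J) (x : J -> sm_car),
    bijective h -> forall s, ssum (x \o h) s <-> ssum x s;
  sum_assoc : forall (I : countType) (J : I -> countType)
      (x : forall i, J i -> sm_car) s,
    (exists2 y : I -> sm_car, (forall i, ssum (x i) (y i)) & ssum y s) <->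
    ssum (fun p : {i : I & J i} => x (tag p) (tagged p)) s
}.
Arguments ssum {_ J}.
Arguments szero {_}.

Definition sigma_hom (M N : sigmaMonoid) (f : M -> N) : Prop :=
  forall (J : countType) (x : J -> M) s, ssum x s -> ssum (f \o x) (f s).

Definition sigma_bilinear (M N L : sigmaMonoid) (f : M -> N -> L) : Prop :=
  forall (I J : countType) (x : I -> M) (y : J -> N) s t,
    ssum x s -> ssum y t ->
    ssum (fun p : I * J => f (x p.1) (y p.2)) (f s t).

Definition sum2 (M : sigmaMonoid) (x y s : M) : Prop :=
  ssum (fun b : bool => if b then x else y) s.

Definition canon_le (M : sigmaMonoid) (x y : M) : Prop := exists z, sum2 x z y.

(* the partial sum of x over the finite set A of indices is defined, equal to s *)
Definition fsum (M : sigmaMonoid) (J : countType) (x : J -> M) (A : {fset J})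
  (s : M) : Prop := ssum (fun j : A => x (val j)) s.

Definition omega_complete (M : sigmaMonoid) : Prop :=
  forall (J : countType) (x : J -> M),
    (forall A : {fset J}, exists s, fsum x A s) -> exists s, ssum x s.

Definition cancellable (M : sigmaMonoid) : Prop :=
  forall x y z s : M, sum2 x y s -> sum2 x z s -> y = z.

Definition is_lub (M : sigmaMonoid) (S : M -> Prop) (s : M) : Prop :=
  (forall x, S x -> canon_le x s) /\
  (forall u, (forall x, S x -> canon_le x u) -> canon_le s u).

Definition is_poset (M : sigmaMonoid) : Prop :=
  [/\ forall x : M, canon_le x x,
      forall x y z : M, canon_le x y -> canon_le y z -> canon_le x z &
      forall x y : M, canon_le x y -> canon_le y x -> x = y].

Definition omega_cpo (M : sigmaMonoid) : Prop :=
  forall f : nat -> M, (forall k, canon_le (f k) (f k.+1)) ->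
    exists s, is_lub (fun x => exists k, x = f k) s.

Definition sums_are_lubs (M : sigmaMonoid) : Prop :=
  forall (J : countType) (x : J -> M) (s : M),
    ssum x s <->
    (forall A : {fset J}, exists t, fsum x A t) /\
    is_lub (fun t => exists A : {fset J}, fsum x A t) s.

Section Sums.
Variable M : sigmaMonoid.

Lemma sum_pair (I J : countType) (x : I -> J -> M) s :
  (exists2 y : I -> M, (forall i, ssum (x i) (y i)) & ssum y s) <->
  ssum (fun p : I * J => x p.1 p.2) s.
Proof.
rewrite (@sum_assoc M I (fun _ => J) x s).
pose h (p : {i : I & J}) : I * J := (tag p, tagged p).
apply: (@sum_reindex M _ _ h (fun p => x p.1 p.2)).
by exists (fun p => @Tagged I p.1 (fun=> J : Type) p.2) => [[i j]|[i j]].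
Qed.

Lemma sum_exchange (I J : countType) (x : I -> J -> M) r c s :
  (forall i, ssum (x i) (r i)) -> ssum r s ->
  (forall j, ssum (x^~ j) (c j)) -> ssum c s.
Proof.
move=> xr rs xc.
have /sum_pair xs : exists2 y : I -> M, (forall i, ssum (x i) (y i)) & ssum y s.
  by exists r.
have bs : bijective (fun p : J * I => (p.2, p.1)).
  by exists (fun p => (p.2, p.1)) => [[]|[]].
move/(@sum_reindex M _ _ (fun p : J * I => (p.2, p.1)) _ bs s): xs.
move=> /(@sum_pair J I (fun j i => x i j)) [y xy ys].
by have -> : c = y by apply: funext => j; apply: sum_uniq (xc j) (xy j).
Qed.

End Sums.

Section Bilin.
Variables (M N L : sigmaMonoid) (f : M -> N -> L).

Lemma sigma_bilinearP : sigma_bilinear f <->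
  (forall x, sigma_hom (f x)) /\ (forall y, sigma_hom (f^~ y)).
Proof.
split=> [bf|[fr fl] I J x y s t xs yt].
  split=> [x J y t yt|y J x s xs].
    have := bf _ _ _ _ _ _ (sum_single x) yt.
    have bh : bijective (fun j : J => (tt, j)).
      by exists snd => // [[[]]].
    by move=> /(sum_reindex _ bh).
  have := bf _ _ _ _ _ _ xs (sum_single y).
  have bh : bijective (fun j : J => (j, tt)).
    by exists fst => // [[? []]].
  by move=> /(sum_reindex _ bh).
apply/(sum_pair (fun i j => f (x i) (y j))).
by exists (fun i => f (x i) t) => [i|]; [apply: fr|apply: (fl t)].
Qed.

End Bilin.

(* A set T of "functions" with evaluation maps ev e into sigma-monoids is a
   sigma-monoid for the pointwise sums as soon as pointwise sums stay in T. *)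
Section Pointwise.
Variables (T E : Type) (N : E -> sigmaMonoid) (ev : forall e, T -> N e).
Hypothesis ev_inj : forall s t, (forall e, ev e s = ev e t) -> s = t.
Hypothesis ev_closed : forall (J : countType) (f : J -> T),
  (forall e, exists s, ssum (ev e \o f) s) ->
  exists s, forall e, ssum (ev e \o f) (ev e s).

Definition psum (J : countType) (f : J -> T) (s : T) : Prop :=
  forall e, ssum (ev e \o f) (ev e s).

Lemma pempty_ex : exists z, psum (of_void T) z.
Proof.
apply: ev_closed => e; exists szero.
by have -> : ev e \o of_void T = of_void (N e); [apply: funext => -[]|exact: sum_empty].
Qed.

Definition pzero : T := projT1 (cid pempty_ex).

Lemma pempty : psum (of_void T) pzero.
Proof. exact: (projT2 (cid pempty_ex)). Qed.

Lemma ev_pzero e : ev e pzero = szero.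
Proof.
apply: (sum_uniq (pempty e)).
by have -> : ev e \o of_void T = of_void (N e); [apply: funext => -[]|exact: sum_empty].
Qed.

Lemma psum_uniq (J : countType) (x : J -> T) s t : psum x s -> psum x t -> s = t.
Proof. by move=> xs xt; apply: ev_inj => e; apply: sum_uniq (xs e) (xt e). Qed.

Lemma psum_single x : psum (fun _ : unit => x) x.
Proof. by move=> e; apply: sum_single. Qed.

Lemma psum_omit (J : countType) (P : pred J) (x : J -> T) :
  (forall j, ~~ P j -> x j = pzero) ->
  forall s, psum (fun j : {j | P j} => x (val j)) s <-> psum x s.
Proof.
move=> x0 s; split=> h e; have /= he := h e.
  by apply/(@sum_omit _ J P) => // j /x0 /= ->; apply: ev_pzero.
by move: he => /(@sum_omit _ J P); apply=> j /x0 /= ->; apply: ev_pzero.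
Qed.

Lemma psum_reindex (J K : countType) (h : K -> J) (x : J -> T) :
  bijective h -> forall s, psum (x \o h) s <-> psum x s.
Proof.
move=> bh s; split=> hs e; first by apply/(sum_reindex _ bh); apply: (hs e).
by have /(sum_reindex _ bh) := hs e.
Qed.

Lemma psum_assoc (I : countType) (J : I -> countType) (x : forall i, J i -> T) s :
  (exists2 y : I -> T, (forall i, psum (x i) (y i)) & psum y s) <->
  psum (fun p : {i : I & J i} => x (tag p) (tagged p)) s.
Proof.
split=> [[y xy ys] e|h].
  apply/(@sum_assoc (N e) I J (fun i j => ev e (x i j))).
  by exists (ev e \o y) => [i|]; [apply: xy|apply: ys].
have he e : exists2 y : I -> N e,
    (forall i, ssum (ev e \o x i) (y i)) & ssum y (ev e s).
  by apply/(@sum_assoc (N e) I J (fun i j => ev e (x i j))); apply: h.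
have /choice[y xy] i : exists y, psum (x i) y.
  by apply: ev_closed => e; have [y xy _] := he e; exists (y i); apply: xy.
exists y => // e; have [z xz zs] := he e.
suff -> : ev e \o y = z by [].
by apply: funext => i; apply: sum_uniq (xy i e) (xz i).
Qed.

Definition pointwise_sigma : sigmaMonoid :=
  @SigmaMonoid T psum pzero psum_uniq pempty psum_single psum_omit
    psum_reindex psum_assoc.

End Pointwise.

Local Open Scope ring_scope.

Section Matrices.
Variable C : numClosedFieldType.

Definition adjmx n m (A : 'M[C]_(n, m)) : 'M[C]_(m, n) := map_mx Num.conj A^T.

(* 0 <= z in a numClosedFieldType says that z is real and nonnegative, so that a
   psd matrix is automatically Hermitian. *)
Definition psd n (A : 'M[C]_n) : Prop :=
  forall v : 'cV[C]_n, 0 <= (adjmx v *m A *m v) 0 0.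

(* The linear extension of a (x) b |-> f a (x) g b (see tensE), written on the
   matrix units so as not to need the linearity of f and g in the definition;
   Mat_n (x) Mat_p is identified with Mat_(np) through the Kronecker product. *)
Definition tens n m p q (f : 'M[C]_n -> 'M[C]_m) (g : 'M[C]_p -> 'M[C]_q)
    (A : 'M[C]_(n * p)) : 'M[C]_(m * q) :=
  \sum_(i < n) \sum_(j < n) \sum_(k < p) \sum_(l < p)
    A (mxtens_index (i, k)) (mxtens_index (j, l)) *:
      tensmx (f (delta_mx i j)) (g (delta_mx k l)).

(* id_k (x) f preserves positivity for all k *)
Definition completely_positive n m (f : 'M[C]_n -> 'M[C]_m) : Prop :=
  forall k (A : 'M[C]_(k * n)), psd A -> psd (tens (@idfun 'M[C]_k) f A).

Definition trace_nonincreasing n m (f : 'M[C]_n -> 'M[C]_m) : Prop :=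
  forall A : 'M[C]_n, psd A -> \tr (f A) <= \tr A.

Lemma tens_linear n m p q (f : 'M[C]_n -> 'M[C]_m) (g : 'M[C]_p -> 'M[C]_q) :
  linear (tens f g).
Proof.
move=> a A B; rewrite /tens.
do 4![rewrite scaler_sumr -big_split /=; apply: eq_bigr => ? _].
by rewrite !mxE scalerDl scalerA.
Qed.

HB.instance Definition _ n m p q f g :=
  GRing.isLinear.Build C _ _ _ (@tens n m p q f g) (tens_linear f g).

Lemma tensmxDl n m p q (A B : 'M[C]_(n, m)) (D : 'M[C]_(p, q)) :
  tensmx (A + B) D = tensmx A D + tensmx B D.
Proof. by apply/matrixP => i j; rewrite !mxE mulrDl. Qed.

Lemma tensmxZl n m p q a (A : 'M[C]_(n, m)) (D : 'M[C]_(p, q)) :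
  tensmx (a *: A) D = a *: tensmx A D.
Proof. by apply/matrixP => i j; rewrite !mxE mulrA. Qed.

Lemma tensmxDr n m p q (A B : 'M[C]_(n, m)) (D : 'M[C]_(p, q)) :
  tensmx D (A + B) = tensmx D A + tensmx D B.
Proof. by apply/matrixP => i j; rewrite !mxE mulrDr. Qed.

Lemma tensmxZr n m p q a (A : 'M[C]_(n, m)) (D : 'M[C]_(p, q)) :
  tensmx D (a *: A) = a *: tensmx D A.
Proof. by apply/matrixP => i j; rewrite !mxE mulrCA. Qed.

Lemma tensmx_suml (I : finType) n m p q (F : I -> 'M[C]_(n, m)) (D : 'M[C]_(p, q)) :
  tensmx (\sum_i F i) D = \sum_i tensmx (F i) D.
Proof. by apply: (big_morph (fun A => tensmx A D)) => [? ?|]; rewrite ?tensmxDl ?tens0mx. Qed.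

Lemma tensmx_sumr (I : finType) n m p q (F : I -> 'M[C]_(n, m)) (D : 'M[C]_(p, q)) :
  tensmx D (\sum_i F i) = \sum_i tensmx D (F i).
Proof. by apply: (big_morph (fun A => tensmx D A)) => [? ?|]; rewrite ?tensmxDr ?tensmx0. Qed.

Lemma tensE n m p q (f : {linear 'M[C]_n -> 'M[C]_m})
    (g : {linear 'M[C]_p -> 'M[C]_q}) a b :
  tens f g (tensmx a b) = tensmx (f a) (g b).
Proof.
rewrite /tens {2}(matrix_sum_delta a) {2}(matrix_sum_delta b).
rewrite linear_sum tensmx_suml; apply: eq_bigr => i _.
rewrite linear_sum tensmx_suml; apply: eq_bigr => j _.
rewrite linearZ_LR tensmxZl linear_sum tensmx_sumr scaler_sumr.
apply: eq_bigr => k _; rewrite linear_sum tensmx_sumr scaler_sumr.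
apply: eq_bigr => l _; rewrite linearZ_LR tensmxZr scalerA.
by rewrite tensmxE.
Qed.

Lemma tensmx_delta n m p q (i : 'I_n) (j : 'I_m) (k : 'I_p) (l : 'I_q) :
  tensmx (delta_mx i j) (delta_mx k l) =
  delta_mx (mxtens_index (i, k)) (mxtens_index (j, l)) :> 'M[C]_(_, _).
Proof.
apply/matrixP => u v.
case: (mxtens_indexP u) => u1 u2; case: (mxtens_indexP v) => v1 v2.
rewrite tensmxE !mxE !(can_eq (@mxtens_indexK _ _)) !xpair_eqE -natrM mulnb.
by rewrite andbACA.
Qed.

Lemma tens_ext n p (V : lmodType C) (F G : {linear 'M[C]_(n * p) -> V}) :
  (forall a b, F (tensmx a b) = G (tensmx a b)) -> F =1 G.
Proof.
move=> FG A; rewrite (matrix_sum_delta A) !linear_sum.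
apply: eq_bigr => u _; rewrite !linear_sum; apply: eq_bigr => v _.
rewrite !linearZ_LR; case: (mxtens_indexP u) => u1 u2.
by case: (mxtens_indexP v) => v1 v2; rewrite -tensmx_delta FG.
Qed.

Lemma tens_comp n m r p q s (f : {linear 'M[C]_n -> 'M[C]_m})
    (f' : {linear 'M[C]_m -> 'M[C]_r}) (g : {linear 'M[C]_p -> 'M[C]_q})
    (g' : {linear 'M[C]_q -> 'M[C]_s}) A :
  tens (f' \o f) (g' \o g) A = tens f' g' (tens f g A).
Proof.
rewrite -[RHS]/((tens f' g' \o tens f g) A).
by apply: tens_ext => a b /=; rewrite !tensE.
Qed.

Lemma tens_id n p (A : 'M[C]_(n * p)) : tens idfun idfun A = A.
Proof. by rewrite -[RHS]/(idfun A); apply: tens_ext => a b /=; rewrite tensE. Qed.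

Lemma psd_sub n m (h : 'I_n -> 'I_m) (A : 'M[C]_m) : psd A -> psd (mxsub h h A).
Proof.
move=> pA v; pose w : 'cV[C]_m := \col_j \sum_(i | h i == j) v i 0.
suff -> : (adjmx v *m mxsub h h A *m v) 0 0 = (adjmx w *m A *m w) 0 0 by [].
rewrite !mxE.
transitivity (\sum_i \sum_j (v j 0)^* * A (h j) (h i) * v i 0).
  apply: eq_bigr => i _; rewrite !mxE mulr_suml; apply: eq_bigr => j _.
  by rewrite !mxE.
rewrite (partition_big h predT) //=; apply: eq_bigr => k _.
rewrite !mxE mulr_sumr; apply: eq_bigr => i /eqP hi.
rewrite -mulr_suml; congr (_ * _).
rewrite (partition_big h predT) //=; apply: eq_bigr => l _.
rewrite !mxE rmorph_sum mulr_suml; apply: eq_bigr => j /eqP hj.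
by rewrite hi hj.
Qed.

Lemma mxsub_cancel n m (h : 'I_n -> 'I_m) (h' : 'I_m -> 'I_n) (A : 'M[C]_m) :
  cancel h' h -> mxsub h' h' (mxsub h h A) = A.
Proof. by move=> hK; apply/matrixP => i j; rewrite !mxE !hK. Qed.

Definition reidx n m (h : 'I_n -> 'I_m) : 'M[C]_m -> 'M[C]_n := mxsub h h.
HB.instance Definition _ n m (h : 'I_n -> 'I_m) :=
  GRing.Linear.copy (@reidx n m h) (mxsub h h).

Lemma cp_reidx n m (h : 'I_n -> 'I_m) : completely_positive (reidx h).
Proof.
move=> k A /(psd_sub (fun u => mxtens_index ((mxtens_unindex u).1, h (mxtens_unindex u).2))).
set H := (X in mxsub X X A) => pA.
suff -> : tens idfun (reidx h) A = reidx H A by [].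
apply: tens_ext => a b; rewrite /= tensE.
apply/matrixP => u v; rewrite /reidx [RHS]mxE.
case: (mxtens_indexP u) => u1 u2; case: (mxtens_indexP v) => v1 v2.
by rewrite /H !mxtens_indexK !tensmxE mxE.
Qed.

Lemma cp_id n : completely_positive (@idfun 'M[C]_n).
Proof. by move=> k A; rewrite tens_id. Qed.

Lemma cp_comp n m p (g : {linear 'M[C]_m -> 'M[C]_p}) (f : {linear 'M[C]_n -> 'M[C]_m}) :
  completely_positive g -> completely_positive f -> completely_positive (g \o f).
Proof.
move=> cg cf k A pA; have := cg k _ (cf k A pA).
by rewrite -tens_comp.
Qed.

Lemma cp_psd n m (f : {linear 'M[C]_n -> 'M[C]_m}) (A : 'M[C]_n) :
  completely_positive f -> psd A -> psd (f A).
Proof.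
move=> cf pA.
have p1 : psd (tensmx (1%:M : 'M[C]_1) A).
  suff -> : tensmx (1%:M : 'M[C]_1) A = reidx (fun u => (mxtens_unindex u).2) A.
    exact: psd_sub.
  apply/matrixP => u v; rewrite !mxE.
  by rewrite !ord1 eqxx mul1r.
have := cf _ _ p1; rewrite tensE => /(psd_sub (fun u => mxtens_index (0, u))) p2.
suff -> : f A = mxsub (fun u => mxtens_index (0, u)) (fun u => mxtens_index (0, u))
   (tensmx (1%:M : 'M[C]_1) (f A)) by exact: p2.
by apply/matrixP => u v; rewrite mxE tensmxE !mxE mul1r.
Qed.

Definition assoc_idx k n p (u : 'I_(k * n * p)) : 'I_(k * (n * p)) :=
  let a := mxtens_unindex u in let b := mxtens_unindex a.1 in
  mxtens_index (b.1, mxtens_index (b.2, a.2)).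
Definition assoc_inv k n p (u : 'I_(k * (n * p))) : 'I_(k * n * p) :=
  let a := mxtens_unindex u in let b := mxtens_unindex a.2 in
  mxtens_index (mxtens_index (a.1, b.1), b.2).

Lemma assoc_idxK k n p : cancel (@assoc_inv k n p) (@assoc_idx k n p).
Proof.
move=> u; case: (mxtens_indexP u) => u1 u2; case: (mxtens_indexP u2) => v1 v2.
by rewrite /assoc_idx /assoc_inv !mxtens_indexK.
Qed.

Lemma reidx_assoc k n p (a : 'M[C]_k) (b : 'M[C]_n) (c : 'M[C]_p) :
  reidx (@assoc_idx k n p) (tensmx a (tensmx b c)) = tensmx (tensmx a b) c.
Proof.
apply/matrixP => u v; rewrite mxE.
case: (mxtens_indexP u) => u' u3; case: (mxtens_indexP u') => u1 u2.
case: (mxtens_indexP v) => v' v3; case: (mxtens_indexP v') => v1 v2.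
by rewrite /assoc_idx !mxtens_indexK !tensmxE mulrA.
Qed.

Lemma reidx_associnv k n p (a : 'M[C]_k) (b : 'M[C]_n) (c : 'M[C]_p) :
  reidx (@assoc_inv k n p) (tensmx (tensmx a b) c) = tensmx a (tensmx b c).
Proof. by rewrite -reidx_assoc /reidx mxsub_cancel //; apply: assoc_idxK. Qed.

Lemma cp_idtens k n m (g : {linear 'M[C]_n -> 'M[C]_m}) :
  completely_positive g -> completely_positive (tens (@idfun 'M[C]_k) g).
Proof.
move=> cg l A pA.
suff -> : tens idfun (tens (@idfun 'M[C]_k) g) A =
    reidx (@assoc_inv l k m) (tens idfun g (reidx (@assoc_idx l k n) A)).
  by apply: psd_sub; apply: cg; apply: psd_sub.
rewrite -[RHS]/((reidx (@assoc_inv l k m) \o (tens idfun g \o reidx (@assoc_idx l k n))) A).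
apply: tens_ext => a B; rewrite /= tensE.
have lF : linear (fun B => tensmx a (tens (@idfun 'M[C]_k) g B)).
  by move=> c B1 B2 /=; rewrite linearP tensmxDr tensmxZr.
have lG : linear (fun B => reidx (@assoc_inv l k m) (tens idfun g (reidx (@assoc_idx l k n) (tensmx a B)))).
  by move=> c B1 B2 /=; rewrite tensmxDr tensmxZr !linearP.
pose FL := GRing.isLinear.Build C _ _ _ _ lF.
pose GL := GRing.isLinear.Build C _ _ _ _ lG.
pose F : {linear 'M[C]_(k * n) -> _} := HB.pack (fun B => tensmx a (tens (@idfun 'M[C]_k) g B)) FL.
pose G : {linear 'M[C]_(k * n) -> _} := HB.pack (fun B => reidx (@assoc_inv l k m) (tens idfun g (reidx (@assoc_idx l k n) (tensmx a B)))) GL.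
apply: (@tens_ext _ _ _ F G) => b c; rewrite /F /G /=.
by rewrite reidx_assoc !tensE reidx_associnv.
Qed.

Definition swap_idx n p (u : 'I_(p * n)) : 'I_(n * p) :=
  mxtens_index ((mxtens_unindex u).2, (mxtens_unindex u).1).

Lemma swap_idxK n p : cancel (@swap_idx n p) (@swap_idx p n).
Proof. by move=> u; case: (mxtens_indexP u) => u1 u2; rewrite /swap_idx !mxtens_indexK. Qed.

(* the symmetry a (x) b |-> b (x) a, see swapE *)
Definition swap n p : 'M[C]_(n * p) -> 'M[C]_(p * n) := reidx (@swap_idx n p).
HB.instance Definition _ n p := GRing.Linear.on (@swap n p).

Lemma swapE n p (a : 'M[C]_n) (b : 'M[C]_p) : swap (tensmx a b) = tensmx b a.
Proof.
apply/matrixP => u v; rewrite mxE.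
case: (mxtens_indexP u) => u1 u2; case: (mxtens_indexP v) => v1 v2.
by rewrite /swap_idx !mxtens_indexK !tensmxE mulrC.
Qed.

Lemma tr_reidx n m (h : 'I_n -> 'I_m) (A : 'M[C]_m) :
  bijective h -> \tr (reidx h A) = \tr A.
Proof.
move=> bh; rewrite /mxtrace (reindex h) /=; last exact: onW_bij.
by apply: eq_bigr => i _; rewrite mxE.
Qed.

Lemma tr_swap n p (A : 'M[C]_(n * p)) : \tr (swap A) = \tr A.
Proof. by apply: tr_reidx; exists (@swap_idx p n); apply: swap_idxK. Qed.

Lemma tens_decomp n m p q (f : {linear 'M[C]_n -> 'M[C]_m}) (g : {linear 'M[C]_p -> 'M[C]_q}) A :
  tens f g A =
  (@swap q m \o (tens (@idfun 'M[C]_q) f \o (@swap n q \o tens (@idfun 'M[C]_n) g))) A.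
Proof.
by apply: tens_ext => a b /=; rewrite !(tensE, swapE).
Qed.

Lemma cp_tens n m p q (f : {linear 'M[C]_n -> 'M[C]_m}) (g : {linear 'M[C]_p -> 'M[C]_q}) :
  completely_positive f -> completely_positive g -> completely_positive (tens f g).
Proof.
move=> cf cg.
have -> : tens f g =
  @swap q m \o (tens (@idfun 'M[C]_q) f \o (@swap n q \o tens (@idfun 'M[C]_n) g)).
  by apply: funext => A; apply: tens_decomp.
have c1 : completely_positive (@swap n q \o tens (@idfun 'M[C]_n) g).
  by apply: (@cp_comp _ _ _ (@swap n q) (tens (@idfun 'M[C]_n) g)); [exact: cp_reidx|exact: cp_idtens].
have c2 : completely_positive (tens (@idfun 'M[C]_q) f \o (@swap n q \o tens (@idfun 'M[C]_n) g)).
  apply: (@cp_comp _ _ _ (tens (@idfun 'M[C]_q) f) (@swap n q \o tens (@idfun 'M[C]_n) g)) => //.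
  exact: cp_idtens.
apply: (@cp_comp _ _ _ (@swap q m) (tens (@idfun 'M[C]_q) f \o (@swap n q \o tens (@idfun 'M[C]_n) g))) => //.
exact: cp_reidx.
Qed.

Definition ptr k n (A : 'M[C]_(k * n)) : 'M[C]_n :=
  \sum_(i < k) reidx (fun u => mxtens_index (i, u)) A.

Lemma ptr_linear k n : linear (@ptr k n).
Proof.
move=> a A B; rewrite /ptr scaler_sumr -big_split; apply: eq_bigr => i _ /=.
exact: linearP.
Qed.
HB.instance Definition _ k n := GRing.isLinear.Build C _ _ _ (@ptr k n) (@ptr_linear k n).

Lemma psd0 n : psd (0 : 'M[C]_n).
Proof. by move=> v; rewrite mulmx0 mul0mx mxE. Qed.

Lemma psdD n (A B : 'M[C]_n) : psd A -> psd B -> psd (A + B).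
Proof. by move=> pA pB v; rewrite mulmxDr mulmxDl mxE addr_ge0. Qed.

Lemma psd_sum I (r : seq I) n (A : I -> 'M[C]_n) : (forall i, psd (A i)) -> psd (\sum_(i <- r) A i).
Proof. by move=> pA; elim/big_ind: _ => [||//]; [exact: psd0|exact: psdD]. Qed.

Lemma psd_ptr k n (A : 'M[C]_(k * n)) : psd A -> psd (ptr A).
Proof. by move=> pA; apply: psd_sum => i; apply: psd_sub. Qed.

Lemma ptrE k n (a : 'M[C]_k) (b : 'M[C]_n) : ptr (tensmx a b) = \tr a *: b.
Proof.
rewrite /ptr /mxtrace scaler_suml; apply: eq_bigr => i _.
by apply/matrixP => u v; rewrite !mxE !mxtens_indexK.
Qed.

Lemma tr_tens k n (a : 'M[C]_k) (b : 'M[C]_n) : \tr (tensmx a b) = \tr a * \tr b.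
Proof.
rewrite /mxtrace mulr_sum; apply: eq_bigr => u _.
by case: (mxtens_indexP u) => i j; rewrite tensmxE mxtens_indexK.
Qed.

Lemma tr_ptr k n (A : 'M[C]_(k * n)) : \tr (ptr A) = \tr A.
Proof.
rewrite -[LHS]/((@mxtrace _ _ \o @ptr k n) A).
apply: (@tens_ext _ _ C^o (@mxtrace _ _ \o @ptr k n) (@mxtrace _ _)) => a b /=.
by rewrite ptrE tr_tens linearZ.
Qed.

Lemma tni_idtens k n m (g : {linear 'M[C]_n -> 'M[C]_m}) :
  trace_nonincreasing g -> trace_nonincreasing (tens (@idfun 'M[C]_k) g).
Proof.
move=> tg A pA; rewrite -tr_ptr -[in leRHS]tr_ptr.
suff -> : ptr (tens (@idfun 'M[C]_k) g A) = (g \o @ptr k n) A.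
  exact/tg/psd_ptr.
rewrite -[LHS]/((@ptr k m \o tens (@idfun 'M[C]_k) g) A).
by apply: tens_ext => a b /=; rewrite tensE !ptrE linearZ.
Qed.

Lemma tni_tens n m p q (f : {linear 'M[C]_n -> 'M[C]_m}) (g : {linear 'M[C]_p -> 'M[C]_q}) :
  trace_nonincreasing f -> trace_nonincreasing g -> completely_positive g ->
  trace_nonincreasing (tens f g).
Proof.
move=> tf tg cg A pA; rewrite tens_decomp /= tr_swap.
have pB : psd (tens (@idfun 'M[C]_n) g A) by apply: cg.
apply: (le_trans (tni_idtens tf (psd_sub (@swap_idx n q) pB))).
by rewrite -/(swap _) tr_swap; apply: tni_idtens.
Qed.

Definition proj n (v : 'cV[C]_n) : 'M[C]_n := v *m adjmx v.

Lemma psd_proj n (v : 'cV[C]_n) : psd (proj v).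
Proof.
move=> w; rewrite /proj mulmxA -mulmxA.
set z := (adjmx v *m w).
have -> : adjmx w *m v = adjmx z.
  rewrite /z; apply/matrixP => i j; rewrite !mxE rmorph_sum.
  by apply: eq_bigr => k _; rewrite !mxE rmorphM /= conjCK mulrC.
rewrite mxE big_ord1 !mxE mulrC -normCK; exact: exprn_ge0.
Qed.

Lemma psd_trproj n (A : 'M[C]_n) (v : 'cV[C]_n) :
  psd A -> 0 <= \tr (A *m proj v).
Proof.
move=> pA; rewrite /proj mulmxA mxtrace_mulC mulmxA.
by rewrite /mxtrace big_ord1.
Qed.

Lemma proj_span n (B : 'M[C]_n) :
  exists s : seq (C * 'cV[C]_n), B = \sum_(k <- s) k.1 *: proj k.2.
Proof.
rewrite (matrix_sum_delta B).
pose sp (D : 'M[C]_n) :=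
  exists s : seq (C * 'cV[C]_n), D = \sum_(k <- s) k.1 *: proj k.2.
have spD D E : sp D -> sp E -> sp (D + E).
  by move=> [s ->] [t ->]; exists (s ++ t); rewrite big_cat.
have sp0 : sp 0 by exists [::]; rewrite big_nil.
have spZ a D : sp D -> sp (a *: D).
  move=> [s ->]; exists [seq (a * k.1, k.2) | k <- s].
  by rewrite big_map scaler_sumr; apply: eq_bigr => k _; rewrite scalerA.
apply: (@big_ind _ sp) => // i _; apply: (@big_ind _ sp) => // j _; apply: (spZ).
pose u : 'cV[C]_n := delta_mx i 0; pose w : 'cV[C]_n := delta_mx j 0.
have -> : delta_mx i j = 4^-1 *: (proj (u + w) + 'i *: proj (u + 'i *: w)
    - proj (u - w) - 'i *: proj (u - 'i *: w)).
  apply: (@scalerI _ _ (4 : C)); first by rewrite pnatr_eq0.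
  rewrite scalerA mulfV ?pnatr_eq0 // scale1r.
  apply/matrixP => k l; rewrite !mxE !big_ord1 !mxE.
  rewrite !eqxx !andbT.
  rewrite !(rmorphD, rmorphB, rmorphM, rmorphN) /= conjCi !conjC_nat.
  rewrite -mulnb natrM.
  move: ((k == i)%:R : C) ((k == j)%:R : C) ((l == i)%:R : C) ((l == j)%:R : C).
  move=> x y x' y'; apply/eqP; rewrite -subr_eq0.
  set L := (X in X == 0).
  have -> : L = 2 * (x * y' - y * x') * ('i ^+ 2 + 1) by rewrite /L; ring.
  by rewrite sqrCi addNr mulr0.
have sp1 (c : C) w' : sp (c *: proj w').
  by exists [:: (c, w')]; rewrite big_seq1.
have spN (c : C) w' : sp (- (c *: proj w')) by rewrite -scaleNr.
apply: (spZ); apply: (spD); first apply: (spD); first apply: (spD) => //.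
- by rewrite -[proj _]scale1r.
- by rewrite -[proj _]scale1r.
- by [].
Qed.

End Matrices.

Local Open Scope classical_set_scope.

(* the filter of all large enough finite subsets of an index type *)
Notation totally := summability.totally.
#[global] Existing Instance summability.totally_filter.

Definition Cplx (R : realType) : numClosedFieldType := R[i]%C.

Section Nets.
Variables (R : realType) (J : choiceType).
Local Notation C := (Cplx R).
Local Notation ReC z := (complex.Re (z : R[i]%C)).
Local Notation ImC z := (complex.Im (z : R[i]%C)).
Local Notation toC r := ((r : R)%:C%C : C).

Lemma totallyP (P : set {fset J}) :
  (\forall F \near totally, P F) <->
  exists F0 : {fset J}, forall F, (F0 `<=` F)%fset -> P F.
Proof.
split=> [[F0 _ h]|[F0 h]]; first by exists F0.
by exists F0.
Qed.

Lemma cvgCP (f : {fset J} -> C) (l : C) :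
  f @ totally --> l <->
  forall e : R, 0 < e -> exists F0 : {fset J}, forall F, (F0 `<=` F)%fset ->
    `|l - f F| < toC e.
Proof.
split=> [/cvgrPdist_lt fl e e0|h].
  by apply/totallyP; apply: fl; rewrite ltcR.
apply/cvgrPdist_lt => e; rewrite ltcE => /andP[/eqP Ie Re0].
have [F0 hF] := h _ Re0; apply/totallyP; exists F0 => F /hF.
suff -> : toC (ReC e) = e by [].
by move: e Ie {Re0 hF h} => [a b] /= ->.
Qed.

Lemma cvgC_nneg (g : J -> C) (l : C) : (forall j, 0 <= g j) ->
  (fun F : {fset J} => \sum_(j <- F) g j) @ totally --> l <->
  ImC l = 0 /\ (\esum_(j in [set: J]) (ReC (g j))%:E = (ReC l)%:E)%E.
Proof.
move=> g0; pose h j := ReC (g j).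
have gE j : g j = toC (h j).
  by rewrite /h; have := ger0_Im (g0 j); case: (g j) => a b /= ->.
have h0 j : 0 <= h j by have := g0 j; rewrite gE ler0c.
pose S (F : {fset J}) := \sum_(j <- F) h j.
have gS (F : {fset J}) : \sum_(j <- F) g j = toC (S F).
  by rewrite /S (eq_bigr (fun j => toC (h j))) // -rmorph_sum.
have Smon (F G : {fset J}) : (F `<=` G)%fset -> S F <= S G.
  move=> FG; rewrite -lee_fin /S -!sumEFin.
  apply: lee_sum_nneg_subfset; first by move=> j; apply/(fsubsetP FG).
  by move=> j _ _; rewrite lee_fin.
have esumP (F : {fset J}) : ((S F)%:E <= \esum_(j in [set: J]) (h j)%:E)%E.
  apply: esum_ge; exists [set` F]; first by split=> //; exact: finite_fset.
  by rewrite fsbig_finite ?finite_fset // set_fsetK sumEFin.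
have esumL (r : R) : (forall F, S F <= r) -> (\esum_(j in [set: J]) (h j)%:E <= r%:E)%E.
  move=> Sr; apply: ge_ereal_sup => /= _ [X [finX _] <-].
  by rewrite fsbig_finite // sumEFin lee_fin; apply: Sr.
under [X in X @ _ --> _]eq_fun do rewrite gS.
split=> [/cvgCP cv|[Il el]].
  have Il : ImC l = 0.
    apply/eqP; rewrite -normr_eq0 eq_le normr_ge0 andbT; apply/ler_addgt0Pl => e e0.
    have [F0 /(_ _ (fsubset_refl _))] := cv _ e0.
    rewrite addr0; case: l {cv} => a b /= ab; rewrite -lecR.
    apply: le_trans (ltW ab); rewrite normc_def lecR /=.
    by rewrite oppr0 addr0 -[leLHS]sqrtr_sqr ler_sqrt ?addr_ge0 ?sqr_ge0 // lerDr sqr_ge0.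
  have lE : l = toC (ReC l) by move: Il; case: (l) => a b /= ->.
  have cvR (e : R) : 0 < e -> exists F0 : {fset J}, forall F, (F0 `<=` F)%fset ->
      `|ReC l - S F| < e.
    move=> /cv[F0 hF]; exists F0 => F /hF; rewrite lE -rmorphB.
    by rewrite normc_def /= expr0n /= addr0 sqrtr_sqr ltcR.
  split=> //; apply/eqP; rewrite eq_le; apply/andP; split.
    apply: esumL => F; apply/ler_addgt0Pl => e e0.
    have [F0 /(_ (F `|` F0)%fset (fsubsetUr _ _))] := cvR _ e0.
    rewrite distrC ltr_norml => /andP[_]; rewrite ltrBlDr => /ltW; apply: le_trans.
    by apply: Smon; apply: fsubsetUl.
  apply/lee_addgt0Pr => e e0.
  have [F0 /(_ _ (fsubset_refl _))] := cvR _ e0.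
  rewrite ltr_norml => /andP[_]; rewrite ltrBlDr => /ltW lS.
  apply: (@le_trans _ _ ((S F0)%:E + e%:E)%E); last exact: leeD2r.
  by rewrite -EFinD lee_fin addrC.
apply/cvgCP => e e0.
have lE : l = toC (ReC l) by move: Il; case: (l) => a b /= ->.
have [F0 hF0] : exists F0, ReC l - e < S F0.
  apply: contrapT => /forallNP nS.
  have : (\esum_(j in [set: J]) (h j)%:E <= (ReC l - e)%:E)%E.
    by apply: esumL => F; rewrite leNgt; apply/negP/nS.
  by rewrite el lee_fin lerBrDr -subr_ge0 opprD addNKr oppr_ge0 leNgt e0.
exists F0 => F /Smon SF; rewrite lE -rmorphB normc_def /= expr0n /= addr0 sqrtr_sqr ltcR.
have SFl : S F <= ReC l by rewrite -lee_fin -el.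
by rewrite ger0_norm ?subr_ge0 // ltrBlDl -ltrBlDr; apply: lt_le_trans SF.
Qed.

Lemma cvgC_exists (g : J -> C) : (forall j, 0 <= g j) ->
  (\esum_(j in [set: J]) (ReC (g j))%:E < +oo)%E ->
  exists l : C, (fun F : {fset J} => \sum_(j <- F) g j) @ totally --> l.
Proof.
move=> g0 goo; exists (toC (fine (\esum_(j in [set: J]) (ReC (g j))%:E)%E)).
apply/(cvgC_nneg _ g0); split=> //=; rewrite fineK //.
rewrite ge0_fin_numE //; apply: esum_ge0 => j _.
by have := g0 j; rewrite lecE lee_fin => /andP[].
Qed.

Lemma cvgC_ge0 (g : J -> C) (l : C) : (forall j, 0 <= g j) ->
  (fun F : {fset J} => \sum_(j <- F) g j) @ totally --> l -> 0 <= l.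
Proof.
move=> g0 /(cvgC_nneg _ g0)[Il el]; rewrite lecE Il eqxx /= -lee_fin -el.
by apply: esum_ge0 => j _; have := g0 j; rewrite lecE lee_fin => /andP[].
Qed.

Lemma cvgC_sum (I : Type) (r : seq I) (f : I -> {fset J} -> C) (l : I -> C) :
  (forall i, f i @ totally --> l i) ->
  (fun F => \sum_(i <- r) f i F) @ totally --> \sum_(i <- r) l i.
Proof.
move=> fl; elim: r => [|i r IH].
  by under eq_fun do rewrite big_nil; rewrite big_nil; exact: cvg_cst.
under eq_fun do rewrite big_cons; rewrite big_cons.
exact: cvgD (fl i) IH.
Qed.

Lemma cvgCZ (a : C) (f : {fset J} -> C) (l : C) :
  f @ totally --> l -> (fun F => a * f F) @ totally --> a * l.
Proof. exact: cvgMl_tmp. Qed.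

Lemma cvg_mxP n m (f : {fset J} -> 'M[C]_(n, m)) (M : 'M[C]_(n, m)) :
  f @ totally --> M <-> forall i j, (fun F => f F i j) @ totally --> M i j.
Proof.
split=> [fM i j|fM].
  exact: (@cvg_comp _ _ _ f (fun M : 'M[C]_(n, m) => M i j) _ _ _ fM (@coord_continuous _ _ _ i j M)).
apply/cvg_ballP => e e0.
have : \forall F \near totally, forall i j, ball (M i j) e (f F i j).
  apply: filter_forall => i; apply: filter_forall => j.
  by move/cvg_ballP: (fM i j); apply.
by apply: filterS => F hF; split.
Qed.

Lemma cvgC_unique (f : {fset J} -> C) (l l' : C) :
  f @ totally --> l -> f @ totally --> l' -> l = l'.
Proof. move=> fl fl'; exact: (@cvg_unique C (@norm_hausdorff _ C^o) _ _ _ _ fl fl'). Qed.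

End Nets.

Section EsumSigma.
Variable R : realType.
Local Open Scope ereal_scope.

Lemma esum_inj (J K : countType) (h : K -> J) (a : J -> \bar R) :
  injective h -> (forall j, 0 <= a j) ->
  \esum_(k in [set: K]) a (h k) <= \esum_(j in [set: J]) a j.
Proof.
move=> hi a0; rewrite -(esum_image setT h) //; last by move=> x y _ _ /hi.
rewrite esum_mkcond; apply: le_esum => j _.
by case: ifPn.
Qed.

Lemma esum_inj_eq (J K : countType) (h : K -> J) (a : J -> \bar R) :
  injective h -> (forall j, 0 <= a j) ->
  (forall j, (forall k, h k <> j) -> a j = 0) ->
  \esum_(k in [set: K]) a (h k) = \esum_(j in [set: J]) a j.
Proof.
move=> hi a0 aN; rewrite -(esum_image setT h) //; last by move=> x y _ _ /hi.
rewrite esum_mkcond; apply: eq_esum => j _.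
case: ifPn => //; rewrite notin_setE => hj; apply/esym/aN => k hk.
by apply: hj; exists k.
Qed.

Lemma esum_sigma (I : countType) (J : I -> countType) (a : forall i, J i -> \bar R) :
  (forall i j, 0 <= a i j) ->
  \esum_(i in [set: I]) \esum_(j in [set: J i]) a i j =
  \esum_(p in [set: {i : I & J i}]) a (tag p) (tagged p).
Proof.
move=> a0.
pose b (i : I) (k : nat) : \bar R := if @pickle_inv (J i) k is Some j then a i j else 0.
have b0 (i : I) (k : nat) : 0 <= b i k by rewrite /b; case: pickle_inv.
have bN (i : I) (k : nat) : (forall j : J i, @choice.pickle (J i) j <> k) -> b i k = 0.
  move=> hk; rewrite /b; case E : (pickle_inv k) => [j|//].
  by have := @pickle_invK (J i) k; rewrite E /= => /hk.
have ab (i : I) (j : J i) : a i j = b i (@choice.pickle (J i) j) by rewrite /b pickleK_inv.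
have bE i : \esum_(j in [set: J i]) a i j = \esum_(k in [set: nat]) b i k.
  rewrite (eq_esum (fun j _ => ab i j)).
  apply: (@esum_inj_eq nat (J i) (@choice.pickle (J i))) => //.
  exact: bN.
rewrite (eq_esum (fun i _ => bE i)) esum_esum //.
rewrite (_ : [set: I] `*`` (fun=> [set: nat]) = [set: I * nat]); last first.
  by apply/seteqP; split.
have abt (p : {i : I & J i}) : a (tag p) (tagged p) = b (tag p) (@choice.pickle (J (tag p)) (tagged p)) by [].
rewrite (eq_esum (fun p _ => abt p)); apply/esym.
apply: (@esum_inj_eq (I * nat)%type _ (fun p : {i : I & J i} => (tag p, @choice.pickle (J (tag p)) (tagged p)))
   (fun q => b q.1 q.2)) => //.
  by move=> [i j] [i' j'] /= [ii]; subst i' => /(pcan_inj (@pickleK_inv (J i))) ->.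
by move=> [i k] hk /=; apply: bN => j jk; apply: (hk (Tagged J j)); rewrite /= jk.
Qed.
End EsumSigma.

Section Superop.
Variable R : realType.
Local Notation C := (Cplx R).
Local Notation ReC z := (complex.Re (z : R[i]%C)).
Local Notation ImC z := (complex.Im (z : R[i]%C)).

Record cpm n m := CPM {
  cpm_fun :> 'M[C]_n -> 'M[C]_m;
  cpm_linear : linear cpm_fun;
  cpm_cp : completely_positive cpm_fun
}.

HB.instance Definition _ n m (f : cpm n m) :=
  GRing.isLinear.Build C _ _ _ (cpm_fun f) (cpm_linear f).

Record superop n m := Superop {
  sop_cpm :> cpm n m;
  sop_tni : trace_nonincreasing sop_cpm
}.

(* Convergence in the finite-dimensional space of linear maps is convergence at
   each matrix; for a finite J this is the plain sum. *)
Definition cpm_sum n m (J : countType) (x : J -> cpm n m) (s : cpm n m) : Prop :=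
  forall A : 'M[C]_n, (fun F : {fset J} => \sum_(j <- F) x j A) @ totally --> s A.

(* a sum in CPM whose value is a superoperator *)
Definition sop_sum n m (J : countType) (x : J -> superop n m) (s : superop n m) :=
  cpm_sum (fun j => sop_cpm (x j)) s.

Lemma cpm_eq n m (f g : cpm n m) : f =1 g -> f = g.
Proof.
case: f g => [f lf cf] [g lg cg] /= /funext fg; subst g.
by congr CPM; apply: Prop_irrelevance.
Qed.

Lemma sop_eq n m (f g : superop n m) : f =1 g -> f = g.
Proof.
case: f g => [f tf] [g tg] /= /cpm_eq fg; subst g.
by congr Superop; apply: Prop_irrelevance.
Qed.

Lemma mulmx_delta_trace n m (M : 'M[C]_(n, m)) i j : \tr (M *m delta_mx j i) = M i j.
Proof.
rewrite /mxtrace (bigD1 i) //= big1 ?addr0 => [|k ki].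
  rewrite mxE (bigD1 j) //= big1 => [|l lj]; last by rewrite mxE (negbTE lj) mulr0.
  by rewrite mxE !eqxx mulr1 addr0.
by rewrite mxE big1 // => l _; rewrite mxE (negbTE ki) andbF mulr0.
Qed.

Lemma cvg_trmul (J : choiceType) n m (f : {fset J} -> 'M[C]_(n, m)) (M : 'M[C]_(n, m)) D :
  f @ totally --> M -> (fun F => \tr (f F *m D)) @ totally --> \tr (M *m D).
Proof.
move=> /cvg_mxP fM; rewrite /mxtrace.
apply: (@cvgC_sum _ _ _ _ (fun i F => (f F *m D) i i) (fun i => (M *m D) i i)) => i.
under eq_fun do rewrite mxE.
rewrite mxE.
apply: (@cvgC_sum _ _ _ _ (fun k F => f F i k * D k i) (fun k => M i k * D k i)) => k.
rewrite mulrC; under eq_fun do rewrite mulrC.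
exact: cvgCZ.
Qed.

Lemma cvg_mx_trace (J : choiceType) n m (f : {fset J} -> 'M[C]_(n, m)) (M : 'M[C]_(n, m)) :
  (forall D, (fun F => \tr (f F *m D)) @ totally --> \tr (M *m D)) ->
  f @ totally --> M.
Proof.
move=> h; apply/cvg_mxP => i j; rewrite -(mulmx_delta_trace M).
by under eq_fun do rewrite -mulmx_delta_trace; exact: h.
Qed.

Lemma cpm_trproj n m (f : cpm n m) u v : 0 <= \tr (f (proj u) *m proj v).
Proof. by apply/psd_trproj/cp_psd; [exact: cpm_cp|exact: psd_proj]. Qed.

(* CPM-maps are determined by the nonnegative reals tp f u v, and their sums are
   computed on them (cpm_sumP): every matrix is a combination of matrices u u^*. *)
Definition tp n m (f : cpm n m) u v : R := ReC (\tr (f (proj u) *m proj v)).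

Lemma tp_ge0 n m (f : cpm n m) u v : 0 <= tp f u v.
Proof. by have := cpm_trproj f u v; rewrite lecE => /andP[]. Qed.

Lemma cvg_span (J : choiceType) n m (f : J -> {linear 'M[C]_n -> 'M[C]_m}) :
  (forall u v, exists l : C,
    (fun F : {fset J} => \sum_(j <- F) \tr (f j (proj u) *m proj v)) @ totally --> l) ->
  forall B D, exists l : C,
    (fun F : {fset J} => \sum_(j <- F) \tr (f j B *m D)) @ totally --> l.
Proof.
move=> h B D; have [s ->] := proj_span B; have [t ->] := proj_span D.
have [l hl] : exists l : 'cV[C]_n -> 'cV[C]_m -> C, forall u v,
    (fun F : {fset J} => \sum_(j <- F) \tr (f j (proj u) *m proj v)) @ totally --> l u v.
  have /choice[l0 hl0] := fun p : 'cV[C]_n * 'cV[C]_m => h p.1 p.2.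
  by exists (fun u v => l0 (u, v)) => u v; exact: (hl0 (u, v)).
exists (\sum_(k <- s) \sum_(k' <- t) (k.1 * k'.1) * l k.2 k'.2).
rewrite (_ : (fun F : {fset J} => _) = (fun F => \sum_(k <- s) \sum_(k' <- t)
    (k.1 * k'.1) * \sum_(j <- F) \tr (f j (proj k.2) *m proj k'.2))); last first.
  apply: funext => F.
  transitivity (\sum_(j <- F) \sum_(k <- s) \sum_(k' <- t)
    (k.1 * k'.1) * \tr (f j (proj k.2) *m proj k'.2)).
    apply: eq_bigr => j _; rewrite [f j _]linear_sum mulmx_suml raddf_sum.
    apply: eq_bigr => k _ /=; rewrite mulmx_sumr raddf_sum.
    apply: eq_bigr => k' _ /=.
    by rewrite [f j _]linearZ_LR -scalemxAl -scalemxAr !mxtraceZ mulrA.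
  rewrite exchange_big /=; apply: eq_bigr => k _.
  rewrite exchange_big /=; apply: eq_bigr => k' _.
  by rewrite mulr_sumr.
apply: cvgC_sum => k; apply: cvgC_sum => k'; exact: cvgCZ.
Qed.

Lemma trproj_ext n m (f g : {linear 'M[C]_n -> 'M[C]_m}) :
  (forall u v, \tr (f (proj u) *m proj v) = \tr (g (proj u) *m proj v)) -> f =1 g.
Proof.
move=> h B; apply/matrixP => i j; rewrite -!mulmx_delta_trace.
have [s ->] := proj_span B; have [t ->] := proj_span (delta_mx j i : 'M[C]_m).
rewrite [f _]linear_sum [g _]linear_sum !mulmx_suml !raddf_sum; apply: eq_bigr => k _ /=.
rewrite !mulmx_sumr !raddf_sum; apply: eq_bigr => k' _ /=.
by rewrite [f _]linearZ_LR [g _]linearZ_LR -!scalemxAl -!scalemxAr !mxtraceZ h.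
Qed.

Lemma cvg_pointwise_exists (J : choiceType) n m (f : J -> {linear 'M[C]_n -> 'M[C]_m}) :
  (forall u v, exists l : C,
    (fun F : {fset J} => \sum_(j <- F) \tr (f j (proj u) *m proj v)) @ totally --> l) ->
  exists2 s : 'M[C]_n -> 'M[C]_m, linear s & forall B,
    (fun F : {fset J} => \sum_(j <- F) f j B) @ totally --> s B.
Proof.
move=> /cvg_span h.
have /choice[l hl] := fun p : 'M[C]_n * 'M[C]_m => h p.1 p.2.
pose s (B : 'M[C]_n) : 'M[C]_m := \matrix_(i, j) l (B, delta_mx j i).
have hs B : (fun F : {fset J} => \sum_(j <- F) f j B) @ totally --> s B.
  apply/cvg_mxP => i j; rewrite /s mxE.
  rewrite (_ : (fun F => _) = (fun F : {fset J} => \sum_(k <- F) \tr (f k B *m delta_mx j i))).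
    exact: (hl (B, delta_mx j i)).
  by apply: funext => F; rewrite summxE; apply: eq_bigr => k _; rewrite mulmx_delta_trace.
exists s => // a A B; apply/matrixP => i j.
have /cvg_mxP/(_ i j) h1 := hs (a *: A + B).
apply: (cvgC_unique h1); rewrite !mxE.
have /cvg_mxP/(_ i j) hA := hs A; have /cvg_mxP/(_ i j) hB := hs B.
rewrite (_ : (fun F => _) = (fun F : {fset J} =>
   a * (\sum_(k <- F) f k A) i j + (\sum_(k <- F) f k B) i j)).
  by have := cvgD (@cvgCZ _ _ a _ _ hA) hB; rewrite /s !mxE; apply.
apply: funext => F; rewrite !summxE mulr_sumr -big_split /=.
by apply: eq_bigr => k _; rewrite linearP !mxE.
Qed.

Lemma cvg_tens (J : choiceType) n m k (f : J -> {linear 'M[C]_n -> 'M[C]_m})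
    (s : {linear 'M[C]_n -> 'M[C]_m}) (A : 'M[C]_(k * n)) :
  (forall B, (fun F : {fset J} => \sum_(j <- F) f j B) @ totally --> s B) ->
  (fun F : {fset J} => \sum_(j <- F) tens (@idfun 'M[C]_k) (f j) A) @ totally -->
  tens (@idfun 'M[C]_k) s A.
Proof.
move=> fs; apply/cvg_mxP => u v.
rewrite (_ : (fun F => _) = (fun F : {fset J} =>
  \sum_(i < k) \sum_(j < k) \sum_(a < n) \sum_(b < n)
    (A (mxtens_index (i, a)) (mxtens_index (j, b)) *
     (delta_mx i j : 'M[C]_k) (mxtens_unindex u).1 (mxtens_unindex v).1) *
     (\sum_(p <- F) f p (delta_mx a b)) (mxtens_unindex u).2 (mxtens_unindex v).2)).
  rewrite /tens summxE.
  apply: cvgC_sum => i; rewrite summxE; apply: cvgC_sum => j.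
  rewrite summxE; apply: cvgC_sum => a; rewrite summxE; apply: cvgC_sum => b.
  have -> : (A (mxtens_index (i, a)) (mxtens_index (j, b)) *:
      tensmx (@idfun 'M[C]_k (delta_mx i j)) (s (delta_mx a b))) u v =
    (A (mxtens_index (i, a)) (mxtens_index (j, b)) *
     (delta_mx i j : 'M[C]_k) (mxtens_unindex u).1 (mxtens_unindex v).1) *
     s (delta_mx a b) (mxtens_unindex u).2 (mxtens_unindex v).2.
    by rewrite !mxE mulrA.
  apply: cvgCZ.
  by have /cvg_mxP := fs (delta_mx a b); apply.
apply: funext => F; rewrite summxE.
under eq_bigr do rewrite /tens summxE.
rewrite exchange_big; apply: eq_bigr => i _ /=.
under eq_bigr do rewrite summxE.
rewrite exchange_big; apply: eq_bigr => j _ /=.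
under eq_bigr do rewrite summxE.
rewrite exchange_big; apply: eq_bigr => a _ /=.
under eq_bigr do rewrite summxE.
rewrite exchange_big; apply: eq_bigr => b _ /=.
rewrite summxE mulr_sumr; apply: eq_bigr => p _.
by rewrite !mxE mulrA.
Qed.

Lemma psd_lim (J : choiceType) n (g : J -> 'M[C]_n) (M : 'M[C]_n) :
  (forall j, psd (g j)) -> (fun F : {fset J} => \sum_(j <- F) g j) @ totally --> M ->
  psd M.
Proof.
move=> pg gM v.
have E (B : 'M[C]_n) : (adjmx v *m B *m v) 0 0 = \tr (B *m proj v).
  by rewrite /proj mulmxA [in RHS]mxtrace_mulC mulmxA /mxtrace big_ord1.
rewrite E; apply: (@cvgC_ge0 _ _ (fun j => \tr (g j *m proj v))).
  by move=> j; apply: psd_trproj.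
have := cvg_trmul (D := proj v) gM.
by under eq_fun do rewrite mulmx_suml raddf_sum.
Qed.

Lemma cpm_sum_exists n m (J : countType) (x : J -> cpm n m) :
  (forall u v, \esum_(j in [set: J]) (tp (x j) u v)%:E < +oo)%E ->
  exists s, cpm_sum x s.
Proof.
move=> xoo.
have [|s ls xs] := @cvg_pointwise_exists J n m x.
  by move=> u v; apply: cvgC_exists => [j|]; [exact: cpm_trproj|exact: xoo].
pose sl : {linear 'M[C]_n -> 'M[C]_m} := HB.pack s (GRing.isLinear.Build C _ _ _ s ls).
have cs : completely_positive s.
  move=> k A pA.
  apply: (@psd_lim J _ (fun j => tens (@idfun 'M[C]_k) (x j) A)).
    by move=> j; apply: cpm_cp.
  exact: (@cvg_tens J n m k x sl A xs).
by exists (CPM ls cs).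
Qed.

Lemma cpm_sumP n m (J : countType) (x : J -> cpm n m) s :
  cpm_sum x s <->
  forall u v, (\esum_(j in [set: J]) (tp (x j) u v)%:E = (tp s u v)%:E)%E.
Proof.
have cvgP t : cpm_sum x t -> forall u v,
    (fun F : {fset J} => \sum_(j <- F) \tr (x j (proj u) *m proj v)) @ totally -->
    \tr (t (proj u) *m proj v).
  move=> xt u v; have := cvg_trmul (D := proj v) (xt (proj u)).
  by under eq_fun do rewrite mulmx_suml raddf_sum.
have h1 t : cpm_sum x t ->
  forall u v, (\esum_(j in [set: J]) (tp (x j) u v)%:E = (tp t u v)%:E)%E.
  move=> /cvgP xt u v.
  by have /(cvgC_nneg _ (fun j => cpm_trproj (x j) u v))[] := xt u v.
split=> [/h1 //|xs].
have [|t xt] := @cpm_sum_exists n m J x; first by move=> u v; rewrite xs ltry.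
suff -> : s = t by [].
apply: cpm_eq; apply: trproj_ext => u v.
have := h1 _ xt u v; rewrite xs => -[] e.
have r (z : C) : 0 <= z -> z = (ReC z)%:C%C.
  by move=> /ger0_Im; case: z => a b /= ->.
by rewrite (r _ (cpm_trproj s u v)) (r _ (cpm_trproj t u v)) -/(tp _ _ _) e.
Qed.

Lemma psd_diag n (A : 'M[C]_n) i : psd A -> 0 <= A i i.
Proof.
move=> /(psd_trproj (delta_mx i 0)); rewrite /proj.
rewrite (_ : adjmx _ = delta_mx 0 i) ?mul_delta_mx ?mulmx_delta_trace //.
by apply/matrixP => k l; rewrite !mxE andbC conjC_nat.
Qed.

Lemma psd_trace n (A : 'M[C]_n) : psd A -> 0 <= \tr A.
Proof. by move=> pA; apply: sumr_ge0 => i _; apply: psd_diag. Qed.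

Lemma sop_sum_exists n m (J : countType) (x : J -> superop n m) :
  (forall u v, \esum_(j in [set: J]) (tp (x j) u v)%:E < +oo)%E ->
  (forall A, psd A -> \esum_(j in [set: J]) (ReC (\tr (x j A)))%:E <= (ReC (\tr A))%:E)%E ->
  exists s, sop_sum x s.
Proof.
move=> /cpm_sum_exists[s xs] xA.
suff ts : trace_nonincreasing s by exists (Superop ts).
move=> A pA.
have := cvg_trmul (D := 1%:M) (xs A).
under eq_fun do rewrite mulmx1 raddf_sum.
rewrite mulmx1 => xsA.
have x0 j : 0 <= \tr (x j A) by apply/psd_trace/cp_psd => //; exact: cpm_cp.
have [Is Es] := (cvgC_nneg _ x0).1 xsA.
by rewrite lecE Is (ger0_Im (psd_trace pA)) eqxx /= -lee_fin -Es xA.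
Qed.

Lemma sop_sum_trace n m (J : countType) (x : J -> superop n m) s A :
  sop_sum x s -> psd A ->
  (\esum_(j in [set: J]) (ReC (\tr (x j A)))%:E = (ReC (\tr (s A)))%:E)%E.
Proof.
move=> xs pA; have := cvg_trmul (D := 1%:M) (xs A).
under eq_fun do rewrite mulmx1 raddf_sum.
rewrite mulmx1 => xsA.
have x0 j : 0 <= \tr (x j A) by apply/psd_trace/cp_psd => //; exact: cpm_cp.
by have [] := (cvgC_nneg _ x0).1 xsA.
Qed.

End Superop.

Section SuperopSigma.
Variables (R : realType) (n m : nat).
Local Notation C := (Cplx R).
Local Notation ReC z := (complex.Re (z : R[i]%C)).
Local Notation Q := (superop R n m).

Lemma sop_sumP (J : countType) (x : J -> Q) (s : Q) :
  sop_sum x s <->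
  forall u v, (\esum_(j in [set: J]) (tp (x j) u v)%:E = (tp s u v)%:E)%E.
Proof. exact: cpm_sumP. Qed.

Lemma sop_sum_uniq (J : countType) (x : J -> Q) s t :
  sop_sum x s -> sop_sum x t -> s = t.
Proof.
move=> xs xt; apply: sop_eq => A; apply/matrixP => i j.
have /cvg_mxP/(_ i j) h1 := xs A; have /cvg_mxP/(_ i j) h2 := xt A.
exact: cvgC_unique h1 h2.
Qed.

Lemma sop0_linear : linear (fun _ : 'M[C]_n => 0 : 'M[C]_m).
Proof. by move=> a A B; rewrite scaler0 addr0. Qed.

Lemma sop0_cp : completely_positive (fun _ : 'M[C]_n => 0 : 'M[C]_m).
Proof.
move=> k A _; rewrite /tens big1 => [|i _]; first exact: psd0.
rewrite big1 // => j _; rewrite big1 // => a _; rewrite big1 // => b _.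
by rewrite tensmx0 scaler0.
Qed.

Lemma sop0_tni : trace_nonincreasing (CPM sop0_linear sop0_cp).
Proof. by move=> A pA /=; rewrite mxtrace0; apply: psd_trace. Qed.

Definition sop0 : Q := Superop sop0_tni.

Lemma tp_sop0 u v : tp sop0 u v = 0.
Proof. by rewrite /tp /= mul0mx mxtrace0. Qed.

Lemma sop_sum_empty : sop_sum (of_void Q) sop0.
Proof.
apply/sop_sumP => u v; rewrite tp_sop0.
by apply: esum1 => -[].
Qed.

Lemma sop_sum_single (x : Q) : sop_sum (fun _ : unit => x) x.
Proof.
apply/sop_sumP => u v.
rewrite (_ : [set: unit] = [set tt]); last by apply/seteqP; split => [[]|[]].
by rewrite esum_set1 // lee_fin tp_ge0.
Qed.

Lemma sop_sum_omit (J : countType) (P : pred J) (x : J -> Q) :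
  (forall j, ~~ P j -> x j = sop0) ->
  forall s, sop_sum (fun j : {j | P j} => x (val j)) s <-> sop_sum x s.
Proof.
move=> x0 s; rewrite !sop_sumP.
suff E u v : (\esum_(j in [set: {j | P j}]) (tp (x (val j)) u v)%:E =
    \esum_(j in [set: J]) (tp (x j) u v)%:E)%E.
  by split=> h u v; rewrite -h E.
apply: (@esum_inj_eq _ J {j | P j} val (fun j => (tp (x j) u v)%:E)).
- exact: val_inj.
- by move=> j; rewrite lee_fin tp_ge0.
move=> j hj; rewrite x0 ?tp_sop0 //; apply/negP => Pj.
exact: (hj (Sub j Pj)).
Qed.

Lemma sop_sum_reindex (J K : countType) (h : K -> J) (x : J -> Q) :
  bijective h -> forall s, sop_sum (x \o h) s <-> sop_sum x s.
Proof.
move=> bh s; rewrite !sop_sumP.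
suff E u v : (\esum_(j in [set: K]) (tp (x (h j)) u v)%:E =
    \esum_(j in [set: J]) (tp (x j) u v)%:E)%E.
  by split=> H u v; rewrite -H E.
apply: (@esum_inj_eq _ J K h (fun j => (tp (x j) u v)%:E)).
- exact: bij_inj.
- by move=> j; rewrite lee_fin tp_ge0.
by case: bh => g hK gK j /(_ (g j)); rewrite gK.
Qed.

Lemma sop_sum_assoc (I : countType) (J : I -> countType)
    (x : forall i, J i -> Q) s :
  (exists2 y : I -> Q, (forall i, sop_sum (x i) (y i)) & sop_sum y s) <->
  sop_sum (fun p : {i : I & J i} => x (tag p) (tagged p)) s.
Proof.
have E u v : (\esum_(i in [set: I]) \esum_(j in [set: J i]) (tp (x i j) u v)%:E =
    \esum_(p in [set: {i : I & J i}]) (tp (x (tag p) (tagged p)) u v)%:E)%E.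
  by apply: (@esum_sigma _ I J (fun i j => (tp (x i j) u v)%:E)) => i j; rewrite lee_fin tp_ge0.
split=> [[y xy ys]|xs].
  apply/sop_sumP => u v; rewrite -E; move/sop_sumP: ys => <-.
  by apply: eq_esum => i _; move/sop_sumP: (xy i).
have /choice[y xy] i : exists y, sop_sum (x i) y.
  have inji : injective (fun j : J i => Tagged J j : {i : I & J i}).
    move=> j j' e.
    by have := congr1 (tagged_as (Tagged J j)) e; rewrite !tagged_asE.
  apply: sop_sum_exists => [u v|A pA].
    move/sop_sumP: xs => /(_ u v) xs; apply: (@le_lt_trans _ _ (tp s u v)%:E); last exact: ltry.
    rewrite -xs.
    apply: (@esum_inj _ {i : I & J i} (J i) (fun j => Tagged J j)
      (fun p => (tp (x (tag p) (tagged p)) u v)%:E)) => // p.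
    by rewrite lee_fin tp_ge0.
  have p0 (p : {i : I & J i}) : 0 <= \tr (x (tag p) (tagged p) A).
    by apply/psd_trace/cp_psd => //; exact: cpm_cp.
  apply: (@le_trans _ _ (ReC (\tr (s A)))%:E).
    rewrite -(sop_sum_trace xs pA).
    apply: (@esum_inj _ {i : I & J i} (J i) (fun j => Tagged J j)
      (fun p => (ReC (\tr (x (tag p) (tagged p) A)))%:E)) => // p.
    by have := p0 p; rewrite lecE lee_fin => /andP[].
  by have := sop_tni s pA; rewrite lecE lee_fin => /andP[].
exists y => //; apply/sop_sumP => u v.
move/sop_sumP: xs => <-; rewrite -E.
by apply: eq_esum => i _; move/sop_sumP: (xy i).
Qed.

Definition superop_sigma : sigmaMonoid :=
  @SigmaMonoid Q (@sop_sum R n m) sop0 sop_sum_uniq sop_sum_empty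
    sop_sum_single sop_sum_omit sop_sum_reindex sop_sum_assoc.

End SuperopSigma.

Section SuperopCat.
Variable R : realType.
Local Notation C := (Cplx R).

Definition cpm_id n : cpm R n n :=
  CPM (linearP (@idfun 'M[C]_n)) (@cp_id C n).
Lemma sop_id_tni n : trace_nonincreasing (cpm_id n).
Proof. by move=> A pA /=. Qed.
Definition sop_id n : superop R n n := Superop (@sop_id_tni n).

Definition cpm_comp n m p (g : cpm R m p) (f : cpm R n m) : cpm R n p :=
  CPM (linearP (g \o f)) (cp_comp (cpm_cp g) (cpm_cp f)).
Lemma sop_comp_tni n m p (g : superop R m p) (f : superop R n m) :
  trace_nonincreasing (cpm_comp g f).
Proof.
move=> A pA /=; apply: le_trans (sop_tni f pA).
by apply: sop_tni; apply: cp_psd => //; exact: cpm_cp.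
Qed.
Definition sop_comp n m p (g : superop R m p) (f : superop R n m) : superop R n p :=
  Superop (sop_comp_tni g f).

Definition cpm_tens n m p q (f : cpm R n m) (g : cpm R p q) : cpm R (n * p) (m * q) :=
  CPM (tens_linear f g) (cp_tens (cpm_cp f) (cpm_cp g)).
Definition sop_tens n m p q (f : superop R n m) (g : superop R p q) :
    superop R (n * p) (m * q) :=
  @Superop _ _ _ (cpm_tens f g) (tni_tens (sop_tni f) (sop_tni g) (cpm_cp g)).

Definition cpm_swap n p : cpm R (n * p) (p * n) :=
  CPM (linearP (@swap C n p)) (cp_reidx (@swap_idx n p)).
Lemma sop_swap_tni n p : trace_nonincreasing (cpm_swap n p).
Proof. by move=> A pA /=; rewrite tr_swap. Qed.
Definition sop_swap n p : superop R (n * p) (p * n) := Superop (@sop_swap_tni n p).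

Lemma sop_swap_natural n m p q (f : superop R n m) (g : superop R p q) :
  sop_comp (sop_swap m q) (sop_tens f g) = sop_comp (sop_tens g f) (sop_swap n p).
Proof.
apply: sop_eq => A.
apply: (@tens_ext C _ _ _ (@swap C m q \o tens f g) (tens g f \o @swap C n p)) => a b /=.
by rewrite swapE !tensE swapE.
Qed.

Lemma sop_compA n m p q (h : superop R p q) (g : superop R m p) (f : superop R n m) :
  sop_comp h (sop_comp g f) = sop_comp (sop_comp h g) f.
Proof. exact: sop_eq. Qed.

Lemma sop_comp1f n m (f : superop R n m) : sop_comp (sop_id m) f = f.
Proof. exact: sop_eq. Qed.

Lemma sop_compf1 n m (f : superop R n m) : sop_comp f (sop_id n) = f.
Proof. exact: sop_eq. Qed.

Lemma sop_comp_bilinear n m p :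
  @sigma_bilinear (superop_sigma R m p) (superop_sigma R n m) (superop_sigma R n p)
    (fun g f => sop_comp g f).
Proof.
apply/sigma_bilinearP; split=> [g J f s fs|f J g s gs] A /=; last exact: (gs (f A)).
apply: cvg_mx_trace => D.
have trE (B : 'M[C]_m) : \tr (g B *m D) =
    \sum_(i < m) \sum_(j < m) \tr (g (delta_mx i j) *m D) * B i j.
  rewrite [in LHS](matrix_sum_delta B) [g _]linear_sum mulmx_suml raddf_sum.
  apply: eq_bigr => i _ /=; rewrite [g _]linear_sum mulmx_suml raddf_sum.
  by apply: eq_bigr => j _ /=; rewrite [g _]linearZ_LR -scalemxAl mxtraceZ mulrC.
rewrite trE.
under eq_fun do rewrite -linear_sum trE.
apply: cvgC_sum => i; apply: cvgC_sum => j; apply: cvgCZ.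
by have /cvg_mxP := fs A; apply.
Qed.

End SuperopCat.

Section Modules.
Variable R : realType.
Local Notation Q n m := (superop_sigma R n m).

Record qmod := QMod {
  qm_obj :> nat -> sigmaMonoid;
  act : forall n m, qm_obj n -> Q m n -> qm_obj m;
  act_bilinear : forall n m, sigma_bilinear (@act n m);
  act_id : forall n (x : qm_obj n), act x (sop_id R n) = x;
  act_comp : forall n m k (x : qm_obj n) (f : Q m n) (g : Q k m),
    act (act x f) g = act x (sop_comp f g)
}.
Arguments act {_ n m}.

(* y(n) = Q(-, n) *)
Definition yoneda (n : nat) : qmod :=
  @QMod (fun k => Q k n) (fun k l g f => sop_comp g f)
    (fun k l => @sop_comp_bilinear R l k n)
    (fun k f => sop_compf1 f)
    (fun k l p h g f => esym (sop_compA h g f)).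

(* the module I *)
Definition qunit : qmod := yoneda 1.

Record qhom (M N : qmod) := QHom {
  qh_fun :> forall n, M n -> N n;
  qh_sum : forall n, sigma_hom (@qh_fun n);
  qh_act : forall n m (x : M n) (f : Q m n),
    qh_fun (act x f) = act (qh_fun x) f
}.
Arguments qh_fun {M N} _ {n}.

Record qbilin (M N L : qmod) := QBilin {
  qb_fun :> forall m n, M m -> N n -> L (m * n)%N;
  qb_sum : forall m n, sigma_bilinear (@qb_fun m n);
  qb_act : forall m n m' n' (x : M m) (y : N n) (f : Q m' m) (g : Q n' n),
    qb_fun (act x f) (act y g) = act (qb_fun x y) (sop_tens f g)
}.
Arguments qb_fun {M N L} _ {m n}.

Lemma act_suml (M : qmod) n m (f : Q m n) : sigma_hom (fun x : M n => act x f).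
Proof. by have /sigma_bilinearP[_] := @act_bilinear M n m; apply. Qed.

Lemma act_sumr (M : qmod) n m (x : M n) : sigma_hom (fun f : Q m n => act x f).
Proof. by have /sigma_bilinearP[+ _] := @act_bilinear M n m; apply. Qed.

Section Hom.
Variables M N : qmod.

Lemma qhom_eq (f g : qhom M N) : (forall n (x : M n), f n x = g n x) -> f = g.
Proof.
case: f g => [f sf af] [g sg ag] /= fg.
have E : f = g by apply: functional_extensionality_dep => n; apply: funext => x; apply: fg.
by subst g; congr QHom; apply: Prop_irrelevance.
Qed.

Definition qhom_ev (e : {n : nat & M n}) (f : qhom M N) : N (tag e) := f _ (tagged e).

Definition hpt n (x : M n) : {n : nat & M n} := existT (fun n => sm_car (M n)) n x.

Lemma qhom_ev_inj (f g : qhom M N) : (forall e, qhom_ev e f = qhom_ev e g) -> f = g.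
Proof. by move=> fg; apply: qhom_eq => n x; apply: (fg (hpt x)). Qed.

Lemma qhom_closed (J : countType) (f : J -> qhom M N) :
  (forall e, exists s, ssum (qhom_ev e \o f) s) ->
  exists s, forall e, ssum (qhom_ev e \o f) (qhom_ev e s).
Proof.
move=> ex; pose s0 e := projT1 (cid (ex e)); have hs0 e := projT2 (cid (ex e)).
pose s n (x : M n) : N n := s0 (hpt x).
have fs n (x : M n) : ssum (fun j => f j n x) (s n x) by exact: (hs0 (hpt x)).
have ss n : sigma_hom (s n).
  move=> K x X xX.
  apply: (@sum_exchange (N n) J K (fun j k => f j n (x k)) (fun j => f j n X)) => //.
  by move=> j; apply: (@qh_sum _ _ (f j) n).
have sa n m (x : M n) (g : Q m n) : s m (act x g) = act (s n x) g.
  apply: (sum_uniq (fs m (act x g))).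
  rewrite (_ : (fun j => _) = (fun x => act x g) \o (fun j => f j n x)).
    by apply: act_suml.
  by apply: funext => j /=; rewrite qh_act.
by exists (QHom ss sa) => -[n x]; apply: fs.
Qed.

(* the hom-set of morphisms M -> N with its pointwise sums *)
Definition qhom_sigma : sigmaMonoid := pointwise_sigma qhom_ev_inj qhom_closed.

End Hom.

Section Bil.
Variables M N L : qmod.

Lemma qbilin_eq (f g : qbilin M N L) :
  (forall m n (x : M m) (y : N n), f m n x y = g m n x y) -> f = g.
Proof.
case: f g => [f sf af] [g sg ag] /= fg.
have E : f = g.
  apply: functional_extensionality_dep => m; apply: functional_extensionality_dep => n.
  by apply: funext => x; apply: funext => y; apply: fg.
by subst g; congr QBilin; apply: Prop_irrelevance.
Qed.

Definition qbilin_ev (e : {p : nat * nat & (M p.1 * N p.2)%type}) (f : qbilin M N L) :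
  L ((tag e).1 * (tag e).2)%N := f _ _ (tagged e).1 (tagged e).2.

Definition bpt m n (x : M m) (y : N n) : {p : nat * nat & (M p.1 * N p.2)%type} :=
  existT (fun p : nat * nat => (M p.1 * N p.2)%type) (m, n) (x, y).

Lemma qbilin_ev_inj (f g : qbilin M N L) :
  (forall e, qbilin_ev e f = qbilin_ev e g) -> f = g.
Proof. by move=> fg; apply: qbilin_eq => m n x y; apply: (fg (bpt x y)). Qed.

Lemma qbilin_closed (J : countType) (f : J -> qbilin M N L) :
  (forall e, exists s, ssum (qbilin_ev e \o f) s) ->
  exists s, forall e, ssum (qbilin_ev e \o f) (qbilin_ev e s).
Proof.
move=> ex; pose s0 e := projT1 (cid (ex e)); have hs0 e := projT2 (cid (ex e)).
pose s m n (x : M m) (y : N n) : L (m * n)%N := s0 (bpt x y).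
have fs m n (x : M m) (y : N n) : ssum (fun j => f j m n x y) (s m n x y).
  exact: (hs0 (bpt x y)).
have ss m n : sigma_bilinear (s m n).
  move=> I K x y X Y xX yY.
  apply: (@sum_exchange (L (m * n)%N) J _ (fun j k => f j m n (x k.1) (y k.2))
    (fun j => f j m n X Y)) => //.
  by move=> j; apply: (@qb_sum _ _ _ (f j) m n).
have sa m n m' n' (x : M m) (y : N n) (g : Q m' m) (h : Q n' n) :
    s m' n' (act x g) (act y h) = act (s m n x y) (sop_tens g h).
  apply: (sum_uniq (fs m' n' (act x g) (act y h))).
  rewrite (_ : (fun j => _) = (fun x => act x (sop_tens g h)) \o (fun j => f j m n x y)).
    by apply: act_suml.
  by apply: funext => j /=; rewrite qb_act.
by exists (QBilin ss sa) => -[[m n] [x y]]; apply: fs.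
Qed.

Definition qbilin_sigma : sigmaMonoid := pointwise_sigma qbilin_ev_inj qbilin_closed.

Lemma qbilin_sumP (J : countType) (f : J -> qbilin M N L) (s : qbilin M N L) :
  @ssum qbilin_sigma J f s <->
  forall m n (x : M m) (y : N n), ssum (fun j => f j m n x y) (s m n x y).
Proof. by split=> [h m n x y|h [[m n] [x y]]]; [exact: (h (bpt x y))|exact: h]. Qed.

End Bil.

(* Since M (x) - represents bilinear maps, the right adjoint M -o - of - (x) M is
   characterised by a bijection, natural in X, between the bilinear maps from
   X, M to L and the morphisms X -> (M -o L).  The Yoneda lemma at X = y(n) forces
   (M -o L)_n to be the bilinear maps from y(n), M to L, with pointwise sums, phi
   acting by precomposition in the first argument.  The adjunction is given by
   curry and uncurry below (curryK, uncurryK), with counit lolli_eval. *)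
Section Lolli.
Variables M L : qmod.

Definition lolli_act_fun n m (b : qbilin (yoneda n) M L) (f : Q m n)
    p k (g : yoneda m p) (x : M k) : L (p * k)%N :=
  b p k (sop_comp f g) x.

Lemma lolli_act_sum n m (b : qbilin (yoneda n) M L) (f : Q m n) p k :
  sigma_bilinear (@lolli_act_fun n m b f p k).
Proof.
move=> I J g x s t gs xt; apply: (@qb_sum _ _ _ b p k I J (fun i => sop_comp f (g i)) x (sop_comp f s) t) => //.
by have /sigma_bilinearP[hb _] := @sop_comp_bilinear R p m n; exact: (hb f I g s gs).
Qed.

Lemma lolli_act_act n m (b : qbilin (yoneda n) M L) (f : Q m n)
    p k p' k' (g : yoneda m p) (x : M k) (h : Q p' p) (h' : Q k' k) :
  lolli_act_fun b f (act g h) (act x h') = act (lolli_act_fun b f g x) (sop_tens h h').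
Proof. by rewrite -qb_act /lolli_act_fun /= sop_compA. Qed.

Definition lolli_act n m (b : qbilin (yoneda n) M L) (f : Q m n) : qbilin (yoneda m) M L :=
  QBilin (@lolli_act_sum n m b f) (@lolli_act_act n m b f).

Lemma lolli_act_bilinear n m :
  @sigma_bilinear (qbilin_sigma (yoneda n) M L) (Q m n) (qbilin_sigma (yoneda m) M L)
    (@lolli_act n m).
Proof.
apply/sigma_bilinearP; split.
  move=> b J f s fs; apply/qbilin_sumP => p k g x /=.
  have /sigma_bilinearP[_ /(_ x) hb] := @qb_sum _ _ _ b p k.
  apply: (hb J (fun j => sop_comp (f j) g)).
  by have /sigma_bilinearP[_ hc] := @sop_comp_bilinear R p m n; exact: (hc g J f s fs).
move=> f J b s /qbilin_sumP bs; apply/qbilin_sumP => p k g x.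
exact: bs.
Qed.

Lemma lolli_act_id n (b : qbilin (yoneda n) M L) : lolli_act b (sop_id R n) = b.
Proof. by apply: qbilin_eq => p k g x; rewrite /= /lolli_act_fun sop_comp1f. Qed.

Lemma lolli_act_comp n m k (b : qbilin (yoneda n) M L) (f : Q m n) (g : Q k m) :
  lolli_act (lolli_act b f) g = lolli_act b (sop_comp f g).
Proof. by apply: qbilin_eq => p l h x; rewrite /= /lolli_act_fun /= /lolli_act_fun sop_compA. Qed.

Definition lolli : qmod :=
  @QMod (fun n => qbilin_sigma (yoneda n) M L) lolli_act lolli_act_bilinear
    lolli_act_id lolli_act_comp.

Definition eval_fun m n (b : lolli m) (x : M n) : L (m * n)%N :=
  (b : qbilin (yoneda m) M L) m n (sop_id R m) x.

Lemma eval_sum m n : sigma_bilinear (@eval_fun m n).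
Proof.
apply/sigma_bilinearP; split=> [b|x J b s /qbilin_sumP bs]; last exact: bs.
by have /sigma_bilinearP[+ _] := @qb_sum _ _ _ b m n; apply.
Qed.

Lemma eval_act m n m' n' (b : lolli m) (x : M n) (f : Q m' m) (g : Q n' n) :
  eval_fun (act b f) (act x g) = act (eval_fun b x) (sop_tens f g).
Proof.
rewrite /eval_fun -qb_act /= /lolli_act_fun /=.
by rewrite sop_compf1 sop_comp1f.
Qed.

Definition lolli_eval : qbilin lolli M L := QBilin eval_sum eval_act.

End Lolli.

Section Curry.
Variables X M L : qmod.

Section CurryFun.
Variable f : qbilin X M L.

Definition curry_elt_fun n (x : X n) p k (g : yoneda n p) (y : M k) : L (p * k)%N :=
  f p k (act x g) y.

Lemma curry_elt_sum n (x : X n) p k : sigma_bilinear (@curry_elt_fun n x p k).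
Proof.
move=> I J g y s t gs yt; apply: (@qb_sum _ _ _ f p k I J (fun i => act x (g i)) y (act x s) t) => //.
exact: (@act_sumr X n p x).
Qed.

Lemma curry_elt_act n (x : X n) p k p' k' (g : yoneda n p) (y : M k) (h : Q p' p) (h' : Q k' k) :
  curry_elt_fun x (act g h) (act y h') = act (curry_elt_fun x g y) (sop_tens h h').
Proof. by rewrite /curry_elt_fun -qb_act act_comp. Qed.

Definition curry_elt n (x : X n) : lolli M L n :=
  QBilin (@curry_elt_sum n x) (@curry_elt_act n x).

Lemma curry_sum n : sigma_hom (@curry_elt n).
Proof.
move=> J x s xs; apply/qbilin_sumP => p k g y /=.
have /sigma_bilinearP[_ /(_ y)] := @qb_sum _ _ _ f p k; apply.
exact: (@act_suml X n p g).
Qed.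

Lemma curry_act n m (x : X n) (g : Q m n) : curry_elt (act x g) = act (curry_elt x) g.
Proof. by apply: qbilin_eq => p k h y /=; rewrite /curry_elt_fun /lolli_act_fun /= /curry_elt_fun act_comp. Qed.

Definition curry : qhom X (lolli M L) := QHom curry_sum curry_act.

End CurryFun.

Section Uncurry.
Variable h : qhom X (lolli M L).

Definition uncurry_fun m n (x : X m) (y : M n) : L (m * n)%N :=
  lolli_eval M L m n (h m x) y.

Lemma uncurry_sum m n : sigma_bilinear (@uncurry_fun m n).
Proof.
move=> I J x y s t xs yt; apply: (@qb_sum _ _ _ (lolli_eval M L) m n I J (fun i => h m (x i)) y (h m s) t) => //.
exact: (@qh_sum _ _ h m).
Qed.

Lemma uncurry_act m n m' n' (x : X m) (y : M n) (f : Q m' m) (g : Q n' n) :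
  uncurry_fun (act x f) (act y g) = act (uncurry_fun x y) (sop_tens f g).
Proof. by rewrite /uncurry_fun -qb_act qh_act. Qed.

Definition uncurry : qbilin X M L := QBilin uncurry_sum uncurry_act.

End Uncurry.

Lemma curryK : cancel curry uncurry.
Proof.
move=> f; apply: qbilin_eq => m n x y /=.
by rewrite /uncurry_fun /= /eval_fun /= /curry_elt_fun act_id.
Qed.

Lemma uncurryK : cancel uncurry curry.
Proof.
move=> h; apply: qhom_eq => n x; apply: qbilin_eq => p k g y /=.
rewrite /curry_elt_fun /= /uncurry_fun qh_act /= /eval_fun /= /lolli_act_fun.
by rewrite sop_compf1.
Qed.

End Curry.

Section Flip.
Variables (M N L : qmod) (f : qbilin M N L).

Definition flip_fun n m (y : N n) (x : M m) : L (n * m)%N :=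
  act (f m n x y) (sop_swap R n m).

Lemma flip_sum n m : sigma_bilinear (@flip_fun n m).
Proof.
have /sigma_bilinearP[h1 h2] := @qb_sum _ _ _ f m n.
apply/sigma_bilinearP; split=> [y|x] J z s zs.
  by apply: (@act_suml L _ _ (sop_swap R n m)); apply: (h2 y).
by apply: (@act_suml L _ _ (sop_swap R n m)); apply: (h1 x).
Qed.

Lemma flip_act n m n' m' (y : N n) (x : M m) (g : Q n' n) (h : Q m' m) :
  flip_fun (act y g) (act x h) = act (flip_fun y x) (sop_tens g h).
Proof. by rewrite /flip_fun qb_act !act_comp sop_swap_natural. Qed.

Definition flip : qbilin N M L := QBilin flip_sum flip_act.

End Flip.

Definition neg (M : qmod) : qmod := lolli M qunit.

(* the canonical morphism: the transpose of the bilinear map (x, b) |-> b x from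
   M, neg M to I *)
Definition to_negneg (M : qmod) : qhom M (neg (neg M)) :=
  curry (flip (lolli_eval M qunit)).

Definition qiso (M N : qmod) (f : qhom M N) : Prop :=
  exists g : qhom N M,
    (forall n (x : M n), g n (f n x) = x) /\ (forall n (y : N n), f n (g n y) = y).

Definition has_representable_basis (M : qmod) : Prop :=
  exists (J : countType) (d : J -> nat) (e : forall j, M (d j))
      (f : forall j, qhom M (yoneda (d j))),
    forall k (x : M k), ssum (fun j => act (e j) (f j k x : Q k (d j))) x.

(* The objects of the full subcategory: morphisms between classical modules, and
   their sums, are those of qhom_sigma. *)
Definition classical (M : qmod) : Prop :=
  has_representable_basis M /\ qiso (to_negneg M).

End Modules.

(* Main.v *)
(* Call a sigma-monoid tame if it is cancellable, omega-complete, and any upper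
   bound of the finite partial sums of a family bounds its sum. Tameness implies
   all the required properties: a chain is the sequence of partial sums of its
   successive differences. It passes from the values of a family of maps to the
   maps with pointwise sums as soon as pointwise differences exist, and the
   pointwise difference of two homomorphisms with values in a cancellable
   sigma-monoid is again a homomorphism. Hence Hom(M, N) is tame when all N_n
   are. Each I_n is tame because the canonical order of Q(n, m) is the order "the
   difference is completely positive", which is closed under limits. If N is
   classical, N_n is isomorphic to a set of bilinear maps into I. *)
From mathcomp Require Import all_boot all_order all_algebra finmap.
From mathcomp Require Import all_classical all_reals all_analysis.
From mathcomp.real_closed Require Import complex mxtens.
Require Import Defs.
Set Implicit Arguments.
Unset Strict Implicit.
Unset Printing Implicit Defensive.
Import numFieldNormedType.Exports.
Import Order.TTheory GRing.Theory Num.Theory.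

(** * Elementary consequences of the axioms of a sigma-monoid; the canonical order *)

Lemma inj_surj_bijective (A B : Type) (f : A -> B) :
  injective f -> (forall b, exists a, f a = b) -> bijective f.
Proof.
move=> fI /choice[g fg]; exists g => // a.
by apply: fI; rewrite fg.
Qed.

Section SigmaMonoid.
Variable M : sigmaMonoid.

Lemma eq_ssum (J : countType) (x y : J -> M) s : x =1 y -> ssum x s -> ssum y s.
Proof. by move=> /funext ->. Qed.

Lemma ssum_bool (x : bool -> M) s : ssum x s <-> sum2 (x true) (x false) s.
Proof.
rewrite /sum2; suff -> : x = fun b => if b then x true else x false by [].
by apply: funext => -[].
Qed.

(** This is associativity over the index set [bool], after reindexing along the bijection between
    [I + J] and the dependent sum of the two-member family [K]. *)
Lemma ssum_sum (I J : countType) (x : I + J -> M) r :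
  ssum x r <-> exists s t,
    [/\ ssum (x \o inl) s, ssum (x \o inr) t & sum2 s t r].
Proof.
pose K (b : bool) : countType := if b then I else J.
pose F (b : bool) : K b -> M :=
  if b return K b -> M then fun i => x (inl i) else fun j => x (inr j).
pose h (p : {b : bool & K b}) : I + J :=
  (if tag p as b return K b -> I + J then fun i => inl i else fun j => inr j)
    (tagged p).
have hb : bijective h.
  exists (fun z : I + J => match z with
    | inl i => Tagged K (i : K true) | inr j => Tagged K (j : K false) end).
    by case=> [[]].
  by case.
have -> : ssum x r <-> ssum (fun p : {b : bool & K b} => F (tag p) (tagged p)) r.
  rewrite -(sum_reindex x hb) (_ : x \o h = fun p => F (tag p) (tagged p)) //.
  by apply: funext => -[[]].
rewrite -sum_assoc; split=> [[y Fy /ssum_bool yr]|[s [t [xs xt str]]]].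
  by exists (y true), (y false); split => //; [exact: (Fy true)|exact: (Fy false)].
by exists (fun b => if b then s else t) => [[]|].
Qed.

Lemma sum2C (x y s : M) : sum2 x y s -> sum2 y x s.
Proof.
have bn : bijective negb by exists negb; exact: negbK.
by move=> xys; apply/(sum_reindex _ bn)/ssum_bool.
Qed.

Lemma ssum_unit (x : unit -> M) s : ssum x s <-> s = x tt.
Proof.
have -> : x = fun=> x tt by apply: funext => -[].
by split=> [xs|->]; [apply: sum_uniq xs (sum_single _)|exact: sum_single].
Qed.

Lemma sum2_sum (x y s : M) :
  sum2 x y s <-> ssum (fun z : unit + unit => if z is inl _ then x else y) s.
Proof.
rewrite ssum_sum; split=> [xys|[a [b [/ssum_unit-> /ssum_unit->]]]] //.
by exists x, y; split=> //; exact/ssum_unit.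
Qed.

Lemma sum2A (x y z t s : M) : sum2 x y t -> sum2 t z s ->
  exists2 u, sum2 y z u & sum2 x u s.
Proof.
move=> /sum2_sum xyt tzs.
pose F (p : (unit + unit) + unit) :=
  match p with inl (inl _) => x | inl (inr _) => y | inr _ => z end.
have Fs : ssum F s.
  by apply/ssum_sum; exists t, z; split=> //; exact/ssum_unit.
pose h (p : unit + (unit + unit)) : (unit + unit) + unit :=
  match p with inl _ => inl (inl tt) | inr (inl _) => inl (inr tt)
             | inr (inr _) => inr tt end.
have hb : bijective h.
  exists (fun p => match p with inl (inl _) => inl tt
    | inl (inr _) => inr (inl tt) | inr _ => inr (inr tt) end).
    by move=> [[]|[[]|[]]].
  by move=> [[[]|[]]|[]].
move: Fs => /(sum_reindex _ hb) /ssum_sum[a [u [/ssum_unit-> yzu xus]]].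
by exists u => //; apply/sum2_sum; apply: eq_ssum yzu => -[].
Qed.

(** Omitting every term leaves a family over an empty type, which reindexes to the empty sum. *)
Lemma ssum_zero (J : countType) : ssum (fun _ : J => szero : M) szero.
Proof.
apply/(@sum_omit M J pred0) => //.
have hb : bijective (fun j : {j : J | pred0 j} => match notF (valP j) return void with end).
  by exists (fun v : void => match v with end) => [[]|[]].
have /(sum_reindex _ hb) := sum_empty M.
by apply: eq_ssum => -[].
Qed.

Lemma sum2x0 (x : M) : sum2 x szero x.
Proof.
apply/ssum_bool/(@sum_omit M bool id) => [[]//|/=].
have hb : bijective (fun _ : {b : bool | id b} => tt).
  exists (fun=> exist _ true isT); last by case.
  by move=> b; apply: val_inj; rewrite /=; case: b => -[].
have /(sum_reindex _ hb) := sum_single x.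
by apply: eq_ssum => -[[]].
Qed.

Lemma canon_le_refl (x : M) : canon_le x x.
Proof. by exists szero; exact: sum2x0. Qed.

Lemma canon_le_trans (x y z : M) : canon_le x y -> canon_le y z -> canon_le x z.
Proof. by move=> [a xay] [b ybz]; have [u _ xuz] := sum2A xay ybz; exists u. Qed.

(** The index set splits into the image of [h] and its complement; by [ssum_sum] both parts have
    sums, and the sum over the complement witnesses the inequality. *)
Lemma ssum_inj (J K : countType) (h : K -> J) (x : J -> M) s : injective h ->
  ssum x s -> exists2 t, ssum (x \o h) t & canon_le t s.
Proof.
move=> hI.
pose P (j : J) := ~~ `[< exists k, h k = j >].
pose g (p : K + {j | P j}) : J := match p with inl k => h k | inr j => val j end.
have gb : bijective g.
  apply: inj_surj_bijective => [|j].
    move=> [k|[j Pj]] [k'|[j' Pj']] //= e.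
    - by rewrite (hI _ _ e).
    - by case/asboolP: Pj'; exists k.
    - by case/asboolP: Pj; exists k'.
    - by congr inr; apply: val_inj.
  have [[k <-]|kj] := pselect (exists k, h k = j); first by exists (inl k).
  have Pj : P j by apply/asboolP.
  by exists (inr (exist _ j Pj)).
move=> /(sum_reindex _ gb)/ssum_sum[t [r [xt xr trs]]].
by exists t => //; exists r.
Qed.

Lemma ssum_fsum (J : countType) (x : J -> M) (A : {fset J}) s :
  ssum x s -> exists2 t, fsum x A t & canon_le t s.
Proof. by move=> xs; apply: ssum_inj xs; exact: val_inj. Qed.

Hypothesis Mcanc : cancellable M.

(* If z + w = 0, the sum Z of infinitely many copies of z exists, as that of
   infinitely many copies of z + w does, and z + Z = Z. *)
Lemma sum2_eq0 (z w : M) : sum2 z w szero -> z = szero.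
Proof.
move=> zw0.
have S : ssum (fun p : nat * bool => if p.2 then z else w) szero.
  apply/(sum_pair (fun _ : nat => fun b : bool => if b then z else w)).
  by exists (fun=> szero) => //; exact: ssum_zero.
have [Z zZ _] : exists2 Z, ssum (fun _ : nat => z) Z & canon_le Z szero.
  by apply: (@ssum_inj _ nat (fun n : nat => (n, true))) S => i j [].
pose h (p : unit + nat) := if p is inr n then n.+1 else 0%N.
have hb : bijective h.
  by apply: inj_surj_bijective => [[[]|i] [[]|j] //= [->]//|[|n]];
    [exists (inl tt)|exists (inr n)].
have /(sum_reindex _ hb)/ssum_sum[a [b [/ssum_unit -> zb zbZ]]] := zZ.
rewrite (sum_uniq zb zZ) in zbZ.
exact: Mcanc (sum2C zbZ) (sum2x0 Z).
Qed.

(** For antisymmetry, x + z = y and y + w = x give x + (z + w) = x + 0. Cancelling x leaves z + w =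
    0, hence z = 0. *)
Lemma canon_le_poset : is_poset M.
Proof.
split; [exact: canon_le_refl|exact: canon_le_trans|].
move=> x y [z xzy] [w ywx]; have [u zwu xux] := sum2A xzy ywx.
rewrite (Mcanc xux (sum2x0 x)) in zwu; rewrite (sum2_eq0 zwu) in xzy.
exact: sum_uniq (sum2x0 x) xzy.
Qed.

End SigmaMonoid.

(** * Tame sigma-monoids and their order-theoretic properties *)

Definition sums_below (M : sigmaMonoid) : Prop :=
  forall (J : countType) (x : J -> M) s u, ssum x s ->
    (forall A t, fsum x A t -> canon_le t u) -> canon_le s u.

Definition tame (M : sigmaMonoid) : Prop :=
  [/\ cancellable M, omega_complete M & sums_below M].

Section Tame.
Variable M : sigmaMonoid.
Hypothesis Mtame : tame M.
Let Mcanc : cancellable M. Proof. by case: Mtame. Qed.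
Let Mcompl : omega_complete M. Proof. by case: Mtame. Qed.
Let Mbelow : sums_below M. Proof. by case: Mtame. Qed.

(** A sum bounds its finite partial sums in every sigma-monoid, by [ssum_fsum]; [sums_below]
    supplies leastness. *)
Lemma tame_sum_lub (J : countType) (x : J -> M) s : ssum x s ->
  is_lub (fun t => exists A : {fset J}, fsum x A t) s.
Proof.
move=> xs; split=> [t [A xt]|u ub]; last first.
  by apply: Mbelow xs _ => A t xt; apply: ub; exists A.
by have [t' xt' ts] := ssum_fsum A xs; rewrite (sum_uniq xt xt').
Qed.

(** For the converse, omega-completeness provides some sum; it is also a least upper bound of the
    partial sums, so antisymmetry identifies it with the given one. *)
Lemma tame_sums_are_lubs : sums_are_lubs M.
Proof.
move=> J x s; split=> [xs|[xA [ub lub]]].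
  split; last exact: tame_sum_lub.
  by move=> A; have [t xt _] := ssum_fsum A xs; exists t.
have [s' xs'] := Mcompl xA; have [ub' lub'] := tame_sum_lub xs'.
have [_ _ anti] := canon_le_poset Mcanc.
by rewrite (anti s s') //; [exact: lub|exact: lub'].
Qed.

Lemma tame_omega_cpo : omega_cpo M.
Proof.
move=> f /choice[d fd].
(* The series of differences starts with [f 0], so that [f k] is the sum of its first k + 1
   terms. *)
pose x n := if n is k.+1 then d k else f 0%N.
have xf k : ssum (fun i : 'I_k.+1 => x i) (f k).
  elim: k => [|k IH].
    have hb : bijective (fun _ : unit => ord0 : 'I_1).
      by exists (fun=> tt) => [[]|i]; rewrite ?ord1.
    by apply/(sum_reindex _ hb)/ssum_unit.
  pose h (p : 'I_k.+1 + unit) : 'I_k.+2 :=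
    if p is inl i then widen_ord (leqnSn _) i else ord_max.
  have hb : bijective h.
    apply: inj_surj_bijective => [[i|[]] [j|[]]|i] //=.
    - by move=> /(congr1 val) /= ij; congr inl; apply: val_inj.
    - by move=> /(congr1 val) /= ij; have := ltn_ord i; rewrite ij ltnn.
    - by move=> /(congr1 val) /= ij; have := ltn_ord j; rewrite -ij ltnn.
    have [ik|] := ltnP i k.+1; first by exists (inl (Ordinal ik)); apply: val_inj.
    move=> ki; exists (inr tt); apply: val_inj => /=.
    by apply/eqP; rewrite eqn_leq ki -ltnS ltn_ord.
  apply/(sum_reindex _ hb)/ssum_sum; exists (f k), (d k); split=> //.
  exact/ssum_unit.
(* A finite set of indices lies in an initial segment. This gives the finite sums required by
   omega-completeness, and makes every upper bound of the chain bound them. *)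
have xA (A : {fset nat}) : exists k t, fsum x A t /\ canon_le t (f k).
  have [k Ak] : exists k, forall j : A, val j < k.+1.
    exists (\max_(j <- A) j) => j; rewrite ltnS.
    by apply: (@leq_bigmax_seq _ _ predT id) => //; exact: valP.
  pose h (j : A) : 'I_k.+1 := Ordinal (Ak j).
  have hI : injective h by move=> i j /(congr1 val) /= ij; apply: val_inj.
  by have [t xt tk] := ssum_inj hI (xf k); exists k, t.
have [|s xs] := Mcompl (x := x); first by move=> A; have [_ [t [xt _]]] := xA A; exists t.
exists s; split=> [_ [k ->]|u ub].
  have [t xt ts] := ssum_inj (@ord_inj k.+1) xs.
  by rewrite (sum_uniq (xf k) xt).
apply: Mbelow xs _ => A t xt; have [k [t' [xt' tk]]] := xA A.
by rewrite (sum_uniq xt xt'); apply: canon_le_trans tk (ub _ _); exists k.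
Qed.

Lemma tame_all : [/\ cancellable M, omega_complete M, is_poset M, omega_cpo M &
  sums_are_lubs M].
Proof.
by split=> //; [exact: canon_le_poset|exact: tame_omega_cpo|exact: tame_sums_are_lubs].
Qed.

End Tame.

(** * Homomorphisms, and transport of tameness to isomorphic and pointwise structures *)

Lemma sum2_hom (M N : sigmaMonoid) (f : M -> N) (x y s : M) : sigma_hom f ->
  sum2 x y s -> sum2 (f x) (f y) (f s).
Proof. by move=> fh /fh /ssum_bool. Qed.

Lemma canon_le_hom (M N : sigmaMonoid) (f : M -> N) (x y : M) : sigma_hom f ->
  canon_le x y -> canon_le (f x) (f y).
Proof. by move=> fh [z xzy]; exists (f z); exact: sum2_hom. Qed.

Lemma sigma_hom_diff (M N : sigmaMonoid) (f g h : M -> N) : cancellable N ->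
  sigma_hom f -> sigma_hom g -> (forall x, sum2 (f x) (h x) (g x)) -> sigma_hom h.
Proof.
move=> Ncanc fh gh fhg J x s xs.
have sw : bijective (fun p : bool * J => (p.2, p.1)).
  by exists (fun p => (p.2, p.1)) => -[].
(* Exchanging the summations over [j] and [b] shows that the [h (x j)] have a sum, and that adding
   it to [f s] gives [g s]; cancelling [f s] identifies it with [h s]. *)
pose F j (b : bool) := if b then f (x j) else h (x j).
have /(sum_pair F)/(sum_reindex _ sw)/(sum_pair (fun b j => F j b))[y Fy] :
    exists2 y : J -> N, (forall j, ssum (F j) (y j)) & ssum y (g s).
  by exists (g \o x) => [j|]; [exact: fhg|exact: gh].
move=> /ssum_bool; rewrite (sum_uniq (Fy true) (fh _ _ _ xs)) => fyg.
by rewrite (Ncanc _ _ _ _ (fhg s) fyg); exact: (Fy false).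
Qed.

Lemma tame_iso (M N : sigmaMonoid) (f : M -> N) (g : N -> M) :
  sigma_hom f -> sigma_hom g -> cancel f g -> cancel g f -> tame M -> tame N.
Proof.
move=> fh gh fK gK [Mcanc Mcompl Mbelow]; split.
- move=> x y z s /(sum2_hom gh) xy /(sum2_hom gh) xz.
  by rewrite -(gK y) (Mcanc _ _ _ _ xy xz) gK.
- move=> J x xA; have [A|s /fh] := Mcompl J (g \o x).
    by have [s /gh xs] := xA A; exists (g s).
  by rewrite (_ : f \o _ = x) => [xs|]; [exists (f s)|apply: funext => j /=].
- move=> J x s u xs ub; rewrite -(gK s) -(gK u); apply: canon_le_hom => //.
  apply: Mbelow (gh _ _ _ xs) _ => A t /fh.
  rewrite (_ : f \o _ = fun j : A => x (val j)) => [/ub/(canon_le_hom gh)|].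
    by rewrite fK.
  by apply: funext => j /=.
Qed.

Section Pointwise.
Variables (T E : Type) (N : E -> sigmaMonoid) (ev : forall e, T -> N e).
Hypothesis ev_inj : forall s t, (forall e, ev e s = ev e t) -> s = t.
Hypothesis ev_closed : forall (J : countType) (f : J -> T),
  (forall e, exists s, ssum (ev e \o f) s) ->
  exists s, forall e, ssum (ev e \o f) (ev e s).
Local Notation P := (pointwise_sigma ev_inj ev_closed).
Hypothesis ev_diff : forall (f g : T) (h : forall e, N e),
  (forall e, sum2 (ev e f) (h e) (ev e g)) -> exists k, forall e, ev e k = h e.

Lemma ev_hom e : @sigma_hom P (N e) (ev e).
Proof. by move=> J x s; apply. Qed.

(** For [sums_below], the values are compared pointwise, and [ev_diff] assembles the chosen
    pointwise differences into one element of [T]. *)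
Lemma tame_pointwise : (forall e, tame (N e)) -> tame P.
Proof.
move=> Nt; split.
- move=> x y z s xy xz; apply: ev_inj => e; have [Ncanc _ _] := Nt e.
  exact: Ncanc (sum2_hom (@ev_hom e) xy) (sum2_hom (@ev_hom e) xz).
- move=> J x xA; apply: ev_closed => e; have [_ Ncompl _] := Nt e.
  by apply: Ncompl => A; have [s xs] := xA A; exists (ev e s); exact: (xs e).
- move=> J x s u xs ub.
  have le e : canon_le (ev e s) (ev e u).
    have [_ _ Nbelow] := Nt e.
    apply: Nbelow (xs e) _ => A t xt; have [t' xt' _] := ssum_fsum A xs.
    rewrite (sum_uniq xt (xt' e)); apply: canon_le_hom (ub _ _ xt').
    exact: ev_hom.
  have [k kh] := ev_diff (fun e => projT2 (cid (le e))); exists k => e; apply/ssum_bool.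
  by rewrite /= kh; exact: projT2 (cid (le e)).
Qed.

End Pointwise.

(** * Differences and tameness for module morphisms and bilinear maps *)

Section Hom.
Variables (R : realType) (M N : qmod R).

(** Compatibility with the action follows by acting on f x + k x = g x and cancelling the image of
    the first term. *)
Lemma qhom_diff (f g : qhom M N) (h : forall e : {n : nat & M n}, N (tag e)) :
  (forall n, cancellable (N n)) ->
  (forall e, sum2 (qhom_ev e f) (h e) (qhom_ev e g)) ->
  exists k : qhom M N, forall e, qhom_ev e k = h e.
Proof.
move=> Ncanc fhg; pose k n (x : M n) : N n := h (hpt x).
have fkg n (x : M n) : sum2 (f n x) (k n x) (g n x) by exact: (fhg (hpt x)).
have ks n : sigma_hom (k n).
  exact: sigma_hom_diff (@Ncanc n) (@qh_sum _ _ _ f n) (@qh_sum _ _ _ g n) (fkg n).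
have ka n m (x : M n) (q : superop_sigma R m n) : k m (act x q) = act (k n x) q.
  have := sum2_hom (@act_suml R N n m q) (fkg n x).
  by rewrite -!qh_act; apply: Ncanc.
by exists (QHom ks ka) => -[n x].
Qed.

Lemma tame_qhom : (forall n, tame (N n)) -> tame (qhom_sigma M N).
Proof.
move=> Nt; apply: tame_pointwise => // f g h; apply: qhom_diff => n.
by case: (Nt n).
Qed.

End Hom.

Section Bilin.
Variables (R : realType) (M N L : qmod R).

Lemma qbilin_diff (f g : qbilin M N L)
    (h : forall e : {p : nat * nat & (M p.1 * N p.2)%type}, L ((tag e).1 * (tag e).2)%N) :
  (forall n, cancellable (L n)) ->
  (forall e, sum2 (qbilin_ev e f) (h e) (qbilin_ev e g)) ->
  exists k : qbilin M N L, forall e, qbilin_ev e k = h e.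
Proof.
move=> Lcanc fhg.
pose k m n (x : M m) (y : N n) : L (m * n)%N := h (bpt x y).
have fkg m n (x : M m) (y : N n) : sum2 (f m n x y) (k m n x y) (g m n x y).
  exact: (fhg (bpt x y)).
have ks m n : sigma_bilinear (k m n).
  have /sigma_bilinearP[f1 f2] := @qb_sum _ _ _ _ f m n.
  have /sigma_bilinearP[g1 g2] := @qb_sum _ _ _ _ g m n.
  apply/sigma_bilinearP; split=> [x|y].
    exact: sigma_hom_diff (@Lcanc _) (f1 x) (g1 x) (fkg m n x).
  exact: sigma_hom_diff (@Lcanc _) (f2 y) (g2 y) (fun x => fkg m n x y).
have ka m n m' n' (x : M m) (y : N n) (p : superop_sigma R m' m)
    (q : superop_sigma R n' n) :
    k m' n' (act x p) (act y q) = act (k m n x y) (sop_tens p q).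
  have := sum2_hom (@act_suml R L _ _ (sop_tens p q)) (fkg m n x y).
  by rewrite -!qb_act; apply: Lcanc.
by exists (QBilin ks ka) => -[[m n] [x y]].
Qed.

Lemma tame_qbilin : (forall n, tame (L n)) -> tame (qbilin_sigma M N L).
Proof.
move=> Lt; apply: tame_pointwise => // f g h; apply: qbilin_diff => n.
by case: (Lt n).
Qed.

End Bilin.

(** * Limits of positive sums and the canonical order of superoperators *)

Local Open Scope classical_set_scope.
Local Open Scope ring_scope.

Lemma cvgC_le (R : realType) (J : choiceType) (g : J -> Cplx R) (l a : Cplx R) :
  (forall j, 0 <= g j) ->
  (fun F : {fset J} => \sum_(j <- F) g j) @ totally --> l ->
  (forall F : {fset J}, \sum_(j <- F) g j <= a) -> l <= a.
Proof.
move=> g0 /(cvgC_nneg _ g0)[Il el] ga.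
(* The empty partial sum gives 0 <= [a], so [a] is real. *)
have Ia : complex.Im (a : R[i]%C) = 0.
  by have := ga fset0; rewrite big_seq_fset0 => /ger0_Im.
rewrite lecE Il Ia eqxx /= -lee_fin -el; apply: ge_ereal_sup => _ [X [finX _] <-].
rewrite fsbig_finite // sumEFin lee_fin.
have := ga (fset_set X); rewrite lecE => /andP[_]; apply: le_trans.
by rewrite raddf_sum.
Qed.

Lemma sum_fsetT (V : nmodType) (J : finType) (F : {fset J}) (g : J -> V) :
  (forall j, j \in F) -> \sum_(j <- F) g j = \sum_j g j.
Proof.
move=> FT; apply: perm_big; apply: uniq_perm => [||j].
- exact: fset_uniq.
- exact: index_enum_uniq.
- by rewrite mem_index_enum FT.
Qed.

Section Tens.
Variables (C : numClosedFieldType) (n m p q : nat).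
Implicit Types f : 'M[C]_n -> 'M[C]_m.

(** Since [tens] is defined on matrix units, bare functions suffice here, and the lemma applies to a
    difference not yet known to be completely positive. *)
Lemma tensD f (g h : 'M[C]_p -> 'M[C]_q) A :
  tens f (fun B => g B + h B) A = tens f g A + tens f h A.
Proof.
rewrite /tens; do 4![rewrite -big_split /=; apply: eq_bigr => ? _].
by rewrite tensmxDr scalerDr.
Qed.

Lemma tens_sumr (J : Type) (r : seq J) f (g : J -> 'M[C]_p -> 'M[C]_q) A :
  tens f (fun B => \sum_(j <- r) g j B) A = \sum_(j <- r) tens f (g j) A.
Proof.
elim: r => [|j r IH].
  rewrite big_nil /tens big1 // => i _; rewrite big1 // => j _.
  rewrite big1 // => k _; rewrite big1 // => l _.
  by rewrite big_nil tensmx0 scaler0.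
rewrite big_cons -IH -tensD; congr tens.
by apply: funext => B; rewrite big_cons.
Qed.

End Tens.

Lemma psd_quad (C : numClosedFieldType) n (A : 'M[C]_n) :
  psd A <-> forall v, 0 <= \tr (A *m proj v).
Proof.
split=> [pA v|pA v]; first exact: psd_trproj.
by have := pA v; rewrite /proj mulmxA mxtrace_mulC mulmxA /mxtrace big_ord1.
Qed.

Section Superop.
Variables (R : realType) (n m : nat).
Local Notation C := (Cplx R).
Local Notation Q := (superop R n m).
Local Notation QS := (superop_sigma R n m).

Lemma sop_sum_finite (J : finType) (x : J -> Q) (s : Q) :
  sop_sum x s <-> forall A, s A = \sum_j x j A.
Proof.
have xA A : (fun F : {fset J} => \sum_(j <- F) x j A) @ totally -->
    \sum_j x j A.
  (* The net of partial sums is constant from the full index set onwards. *)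
  apply: cvg_near_cst; apply/totallyP; exists [fset j | j : J]%fset => F JF.
  apply: (@sum_fsetT _ J F (fun j => x j A)) => j.
  by apply/(fsubsetP JF)/imfsetP; exists j.
split=> [xs A|sE A]; last by rewrite sE.
apply/matrixP => i j.
have /cvg_mxP/(_ i j) h1 := xs A; have /cvg_mxP/(_ i j) h2 := xA A.
exact: cvgC_unique h1 h2.
Qed.

Lemma sop_fsum (J : countType) (x : J -> QS) (F : {fset J}) (s : QS) :
  fsum x F s <-> forall A, (s : Q) A = \sum_(j <- F) (x j : Q) A.
Proof.
rewrite /fsum [X in X <-> _](@sop_sum_finite F (fun j => x (val j)) s).
by split=> sE A; rewrite sE (big_seq_fsetE _ _ predT (fun j => (x j : Q) A)).
Qed.

Lemma sop_sum2 (x y s : QS) :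
  sum2 x y s <-> forall A, (s : Q) A = (x : Q) A + (y : Q) A.
Proof.
rewrite /sum2 [X in X <-> _](@sop_sum_finite bool (fun b => if b then x else y) s).
by split=> sE A; rewrite sE big_bool.
Qed.

Lemma cancellable_sop : cancellable QS.
Proof.
move=> x y z s /sop_sum2 sy /sop_sum2 sz; apply: sop_eq => A.
by apply: (addrI ((x : Q) A)); rewrite -sy -sz.
Qed.

(** The hypothesis says that [u - s] is completely positive. Its trace is at most that of [u],
    because [s] has nonnegative trace on positive matrices, so it is a superoperator. *)
Lemma sop_canon_le (s u : Q) :
  (forall k (A : 'M[C]_(k * n)) v, psd A ->
    \tr (tens (@idfun 'M[C]_k) s A *m proj v) <=
    \tr (tens (@idfun 'M[C]_k) u A *m proj v)) ->
  @canon_le QS s u.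
Proof.
move=> su; pose d (A : 'M[C]_n) : 'M[C]_m := u A - s A.
have dl : linear d by move=> a A B; rewrite /d (cpm_linear u) (cpm_linear s) scalerBr opprD addrACA.
have ud k A : tens (@idfun 'M[C]_k) u A = tens idfun s A + tens idfun d A.
  by rewrite -tensD; congr tens; apply: funext => B; rewrite /d addrC subrK.
have dcp : completely_positive d.
  move=> k A pA; apply/psd_quad => v; have := su k A v pA.
  by rewrite ud mulmxDl mxtraceD lerDl.
have dt : trace_nonincreasing (CPM dl dcp).
  move=> A pA /=; rewrite /d raddfB; apply: le_trans (sop_tni u pA).
  by rewrite gerBl; apply/psd_trace/cp_psd => //; exact: cpm_cp.
by exists (Superop dt); apply/sop_sum2 => A; rewrite /= /d addrC subrK.
Qed.

(** Each number compared in [sop_canon_le] is, for [s], the limit of a series of nonnegative terms.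
    Its partial sums are bounded by the number for [u], which exceeds each of them by the
    contribution of a completely positive [z]; [cvgC_le] passes to the limit. *)
Lemma sums_below_sop : sums_below QS.
Proof.
move=> J x s u xs ub; apply: sop_canon_le => k A v pA.
have := cvg_trmul (D := proj v) (@cvg_tens R J n m k x s A xs).
under eq_fun do rewrite mulmx_suml raddf_sum.
move=> /cvgC_le; apply=> [j|F]; first exact/psd_trproj/cpm_cp.
have [t xt _] := ssum_fsum F xs; have [z] := ub _ _ xt.
move/sop_fsum: xt => tE /sop_sum2 uE.
have -> : (u : Q) = (fun B => \sum_(j <- F) (x j : Q) B + (z : Q) B) :> (_ -> _).
  by apply: funext => B; rewrite uE tE.
rewrite tensD mulmxDl mxtraceD tens_sumr mulmx_suml raddf_sum lerDl.
exact/psd_trproj/cpm_cp.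
Qed.

End Superop.

(** * Omega-completeness of superoperators with values in dimension one *)

Section Functionals.
Variables (R : realType) (n : nat).
Local Notation C := (Cplx R).
Local Notation ReC z := (complex.Re (z : R[i]%C)).
Local Notation Q := (superop R n 1).
Local Notation QS := (superop_sigma R n 1).

Lemma omega_complete_sop : omega_complete QS.
Proof.
move=> J x xF.
have x0 j A : psd A -> 0 <= \tr ((x j : Q) A).
  by move=> pA; apply/psd_trace/cp_psd => //; exact: cpm_cp.
have xA (X : set J) A : finite_set X -> psd A ->
    \sum_(j <- fset_set X) ReC (\tr ((x j : Q) A)) <= ReC (\tr A).
  move=> finX pA; have [s /sop_fsum sE] := xF (fset_set X).
  have := sop_tni s pA; rewrite sE raddf_sum lecE => /andP[_].
  by rewrite raddf_sum.
apply: (@sop_sum_exists R n 1 J x) => [u v|].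
  (* A matrix of size one is determined by its trace, so [tp] is a trace scaled by the squared norm
     of [v]. The finite partial sums being superoperators, the traces add up to at most that of
     [proj u]. *)
  have tpE j : tp (x j : Q) u v =
      ReC (proj v 0 0) * ReC (\tr ((x j : Q) (proj u))).
    rewrite /tp !trace_mx11 mxE big_ord1 mulrC.
    have := x0 j _ (psd_proj u); rewrite trace_mx11 => /ger0_Im.
    move: ((x j : Q) (proj u) 0 0) (proj v 0 0) => [a b] [c d] /= ->.
    by rewrite mulr0 subr0.
  have v0 : 0 <= ReC (proj v 0 0).
    by have := psd_diag 0 (psd_proj v); rewrite lecE => /andP[].
  apply: (@le_lt_trans _ _ (ReC (proj v 0 0) * ReC (\tr (proj u)))%:E); last exact: ltry.
  apply: ge_ereal_sup => _ [X [finX _] <-].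
  rewrite fsbig_finite // sumEFin lee_fin; under eq_bigr do rewrite tpE.
  by rewrite -mulr_sumr; apply: ler_wpM2l => //; apply: xA => //; exact: psd_proj.
move=> A pA; apply: ge_ereal_sup => _ [X [finX _] <-].
by rewrite fsbig_finite // sumEFin lee_fin; exact: xA.
Qed.

End Functionals.

(** * Tameness of the unit module and of classical modules, and the conclusion *)

Lemma tame_qunit (R : realType) n : tame (qunit R n).
Proof.
by split; [exact: cancellable_sop|exact: omega_complete_sop|exact: sums_below_sop].
Qed.

(** The component at [n] of the double dual is the set of bilinear maps from [yoneda n] and [neg N]
    to the unit. It is tame by [tame_qbilin], and the inverse [g] of the canonical morphism carries
    this over to [N n]. *)
Lemma tame_classical (R : realType) (N : qmod R) n : classical N -> tame (N n).
Proof.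
move=> [_ [g [gK Kg]]].
apply: (tame_iso (@qh_sum _ _ _ g n) (@qh_sum _ _ _ (to_negneg N) n) (Kg n) (gK n)).
by apply: tame_qbilin => k; exact: tame_qunit.
Qed.

Theorem lemma30 (R : realType) :
  (forall M : qmod R,
    [/\ cancellable (qhom_sigma M (qunit R)),
        omega_complete (qhom_sigma M (qunit R)),
        is_poset (qhom_sigma M (qunit R)),
        omega_cpo (qhom_sigma M (qunit R)) &
        sums_are_lubs (qhom_sigma M (qunit R))]) /\
  (forall M N : qmod R, classical M -> classical N ->
    [/\ cancellable (qhom_sigma M N),
        omega_complete (qhom_sigma M N),
        is_poset (qhom_sigma M N),
        omega_cpo (qhom_sigma M N) &
        sums_are_lubs (qhom_sigma M N)]).
Proof.
split=> [M|M N _ Nc]; apply/tame_all/tame_qhom => n; first exact: tame_qunit.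
exact: tame_classical.
Qed.
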